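(* Let $1\ge\beta_b\ge\beta_\Sigma>0$, $L_b\ge 0$, $L_\Sigma>0$, $r\in\{0,\dots,d-1\}$, assume $n^{-1}\lesssim h$, and fix $\alpha\in(0,1)$. Consider the test $\varphi_\alpha=\mathbf 1(T_{n,h}>\kappa_\alpha)$. There exist constants $c_1,c_2>0$ (depending only on the dimension $d$ and on the implied constant in $n^{-1}\lesssim h$) such that the following holds. (i) (No spectral gap.) With critical value $$\kappa_\alpha=h^{\beta_\Sigma}\bigl(c_1L_\Sigma+c_2L_b^2n^{-1}h^{\beta_b}\bigr)\alpha^{-1},$$ the test has level $\alpha$ uniformly over $\mathcal H_0(r,\beta_b,\beta_\Sigma,L_b,L_\Sigma)$: $$\sup_{(\Sigma,b)\in\mathcal H_0(r,\beta_b,\beta_\Sigma,L_b,L_\Sigma)}\mathbb P_{(\Sigma,b)}(\varphi_\alpha=1)\le\alpha .$$ (ii) (Minimal spectral gap $\underline\lambda_r>0$.) With critical value $$\kappa_\alpha=h^{2\beta_\Sigma}\bigl(c_1\underline\lambda_r^{-1}L_\Sigma^2+c_2L_b^2n^{-1}\bigr)\alpha^{-1},$$ the test has level $\alpha$ uniformly over $\mathcal H_0^{\mathrm{gap}}(r,\beta_b,\beta_\Sigma,L_b,L_\Sigma,\underline\lambda_r)$: $$\sup_{(\Sigma,b)\in\mathcal H_0^{\mathrm{gap}}(r,\beta_b,\beta_\Sigma,L_b,L_\Sigma,\underline\lambda_r)}\mathbb P_{(\Sigma,b)}(\varphi_\alpha=1)\le\alpha .$$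
   Context: Model. On a filtered probability space $(\Omega,\mathcal F,(\mathcal F_t)_{t\ge0},\mathbb P)$ let $dX(t)=b(t)\,dt+\sigma(t)\,dW(t)$, $t\in[0,1]$, be $\mathbb R^d$-valued, where $W$ is an $m$-dimensional standard Brownian motion (with respect to the filtration), $b$ is an adapted $\mathbb R^d$-valued process (measurable, so that the integrals below make sense) with $\mathbb E[\int_0^1\|b(t)\|dt]<\infty$, and $\sigma(t)\in\mathbb R^{d\times m}$ is deterministic with $\int_0^1\mathrm{tr}(\sigma(t)\sigma(t)^\top)dt<\infty$. The spot covariance is $\Sigma(t)=\sigma(t)\sigma(t)^\top$. $\mathbb P_{(\Sigma,b)}$ denotes probability under the model with spot covariance $\Sigma$ and drift $b$. Observations $X(i/n)$, $i=0,\dots,n$. Block length $h\in(0,1]$ with $nh,h^{-1}\in\mathbb N$; blocks $I_k=[kh,(k+1)h]$, $k=0,\dots,h^{-1}-1$. $\Delta X_{ik}=X(kh+i/n)-X(kh+(i-1)/n)$, $i=1,\dots,nh$. With $v^{\otimes2}=vv^\top$, the re-centred estimator is $$\hat\Sigma^{kh}=h^{-1}\sum_{i=1}^{nh}\Bigl(\Delta X_{ik}-(nh)^{-1}\sum_{j=1}^{nh}\Delta X_{jk}\Bigr)^{\otimes2}.$$ $\lambda_1(A)\ge\dots\ge\lambda_d(A)$ are the ordered eigenvalues of a symmetric matrix $A$. The test statistic is $T_{n,h}=\sum_{k=0}^{h^{-1}-1}h\,\lambda_{r+1}(\hat\Sigma^{kh})$. Classes. $\mathbb R^{d\times d}_{\mathrm{spd}}$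 is the set of symmetric positive semi-definite matrices; $\|\cdot\|$ is the Euclidean/spectral norm. $\mathcal C^{\beta_\Sigma}(L_\Sigma)$ is the set of $\Sigma:[0,1]\to\mathbb R^{d\times d}_{\mathrm{spd}}$ with $\|\Sigma(t)-\Sigma(s)\|\le L_\Sigma|t-s|^{\beta_\Sigma}$ for all $s,t\in[0,1]$. $\mathcal H^{\beta_b}(L_b)$ is the class of adapted $\mathbb R^d$-valued processes $b$ on $[0,1]$ with $\mathbb E[\int_0^1\|b(t)\|dt]<\infty$ and $\mathbb E[\|b(s)-b(t)\|^4]^{1/4}\le L_b|s-t|^{\beta_b}$ for all $0\le t\le s\le1$. $\mathcal H_0(r,\beta_b,\beta_\Sigma,L_b,L_\Sigma)$ is the set of $(\Sigma,b)\in C([0,1];\mathbb R^{d\times d}_{\mathrm{spd}})\times\mathcal H^{\beta_b}(L_b)$ with $\sup_{t\in[0,1]}\mathrm{rank}(\Sigma(t))\le r$ and $\Sigma\in\mathcal C^{\beta_\Sigma}(L_\Sigma)$. $\mathcal H_0^{\mathrm{gap}}(r,\beta_b,\beta_\Sigma,L_b,L_\Sigma,\underline\lambda_r)$ is the subset of those $(\Sigma,b)$ with additionally $\inf_{t\in[0,1]}\lambda_r(\Sigma(t))\ge\underline\lambda_r$ (this condition is void if $r=0$). $n^{-1}\lesssim h$ means $n^{-1}\le Kh$ for a constant $K>0$ independent of $n$ and $h$ (since $nh\in\mathbb N$ this holds with $K=1$). *)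

(* Defs.v *)
From HB Require Import structures.
From mathcomp Require Export all_boot all_order all_algebra.
From mathcomp Require Export all_classical all_reals all_analysis.
Set Implicit Arguments.
Unset Strict Implicit.
Unset Printing Implicit Defensive.
Export Order.TTheory GRing.Theory Num.Theory.
Export numFieldNormedType.Exports.
#[export] Set Warnings "-notation-overridden".
Global Open Scope classical_set_scope.
Global Open Scope ring_scope.

(* ------------------------------------------------------------------------ *)
(* Matrices                                                                 *)
(* ------------------------------------------------------------------------ *)

(* The library norm on matrices is the max-norm, hence the next two. *)
Definition enorm (R : realType) (d : nat) (v : 'cV[R]_d) : R :=
  Num.sqrt (\sum_i v i 0 ^+ 2).

Definition spectral_norm (R : realType) (d : nat) (A : 'M[R]_d) : R :=
  sup [set enorm (A *m x) | x in [set x : 'cV[R]_d | enorm x <= 1]].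

Definition frobenius_sq (R : realType) (d m : nat) (A : 'M[R]_(d, m)) : R :=
  \tr (A *m A^T).

Definition outer (R : realType) (d : nat) (v : 'cV[R]_d) : 'M[R]_d :=
  v *m v^T.

Definition spd (R : realType) (d : nat) : set 'M[R]_d :=
  [set A | A^T = A /\ forall x : 'cV[R]_d, 0 <= (x^T *m A *m x) 0 0].

(* Eigenvalues in nonincreasing order, repeated according to multiplicity.
   The defining set is a singleton when all eigenvalues of [A] are real, in
   particular when [A] is symmetric; otherwise it is empty. *)
Definition eigenvalues (R : realType) (d : nat) (A : 'M[R]_d) : seq R :=
  xget [::] [set s : seq R | sorted >=%R s /\
                             char_poly A = \prod_(x <- s) ('X - x%:P)].

(* [lambda k A] is the [k]-th largest eigenvalue, with [k] counted from 1. *)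
Definition lambda (R : realType) (d : nat) (k : nat) (A : 'M[R]_d) : R :=
  nth 0 (eigenvalues A) k.-1.

(* ------------------------------------------------------------------------ *)
(* Filtrations and Brownian motion                                          *)
(* ------------------------------------------------------------------------ *)

Record filtration (disp : measure_display) (Omega : measurableType disp)
    (R : realType) (F : R -> set (set Omega)) : Prop := {
  filtration_sigma : forall t : R, 0 <= t -> sigma_algebra [set: Omega] (F t);
  filtration_sub : forall t : R, 0 <= t -> F t `<=` measurable;
  filtration_mono : forall s t : R, 0 <= s -> s <= t -> F s `<=` F t }.

(* The sigma-algebra generated by a random vector. *)
Definition sigma_of (Omega : Type) (R : realType) (d : nat)
    (Y : Omega -> 'cV[R]_d) : set (set Omega) :=
  <<s [set A | exists (i : 'I_d) (B : set R),
         measurable B /\ A = (fun w => Y w i 0) @^-1` B] >>.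

Definition random_vector (disp : measure_display) (Omega : measurableType disp)
    (R : realType) (d : nat) (Y : Omega -> 'cV[R]_d) : Prop :=
  forall i, measurable_fun [set: Omega] (fun w => Y w i 0).

Definition adapted (Omega : Type) (R : realType) (d : nat)
    (F : R -> set (set Omega)) (D : set R) (Y : R -> Omega -> 'cV[R]_d) : Prop :=
  forall t, D t -> sigma_of (Y t) `<=` F t.

Definition independent (disp : measure_display) (Omega : measurableType disp)
    (R : realType) (P : probability Omega R) (G H : set (set Omega)) : Prop :=
  forall A B, G A -> H B -> P (A `&` B) = (P A * P B)%E.

(* [Y] has law N(0, v I_m), v > 0: its law is the product of the N(0, v),
   which is determined by its values on rectangles.  The last argument of
   [normal_prob] is the standard deviation. *)
Definition isotropic_gaussian (disp : measure_display)
    (Omega : measurableType disp) (R : realType) (P : probability Omega R)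
    (m : nat) (v : R) (Y : Omega -> 'cV[R]_m) : Prop :=
  forall B : 'I_m -> set R, (forall j, measurable (B j)) ->
    P [set w | forall j, B j (Y w j 0)]
    = (\prod_(j < m) normal_prob 0 (Num.sqrt v) (B j))%E.

Record brownian_motion (disp : measure_display) (Omega : measurableType disp)
    (R : realType) (P : probability Omega R) (F : R -> set (set Omega))
    (m : nat) (W : R -> Omega -> 'cV[R]_m) : Prop := {
  bm_adapted : adapted F [set t | 0 <= t] W;
  bm_start : {ae P, forall w, W 0 w = 0};
  bm_continuous :
    {ae P, forall w, {within [set t : R | 0 <= t], continuous (W ^~ w)}};
  bm_gaussian : forall s t : R, 0 <= s -> s < t ->
    isotropic_gaussian P (t - s) (fun w => W t w - W s w);
  bm_independent : forall s t : R, 0 <= s -> s < t ->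
    independent P (F s) (sigma_of (fun w => W t w - W s w)) }.

(* ------------------------------------------------------------------------ *)
(* Stochastic integral of a deterministic matrix-valued integrand           *)
(* ------------------------------------------------------------------------ *)

(* A triple (a, b, A) stands for the function equal to A on ]a, b] and to 0
   elsewhere; a list of triples stands for the sum of these functions. *)
Definition step_code (R : realType) (d m : nat) : Type :=
  seq (R * R * 'M[R]_(d, m)).

Definition step_fun (R : realType) (d m : nat) (s : step_code R d m) (x : R) :
    'M[R]_(d, m) :=
  \sum_(p <- s) \1_(`]p.1.1, p.1.2]%classic) x *: p.2.

Definition step_integral (Omega : Type) (R : realType) (d m : nat)
    (W : R -> Omega -> 'cV[R]_m) (s : step_code R d m) (w : Omega) : 'cV[R]_d :=
  \sum_(p <- s) p.2 *m (W p.1.2 w - W p.1.1 w).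

(* [Z] is a version of \int_0^t f(u) dW(u), the L^2(P)-limit of the integrals
   of step functions converging to [f] in L^2([0,t]). *)
Definition is_stochastic_integral (disp : measure_display)
    (Omega : measurableType disp) (R : realType) (P : probability Omega R)
    (d m : nat) (W : R -> Omega -> 'cV[R]_m) (f : R -> 'M[R]_(d, m)) (t : R)
    (Z : Omega -> 'cV[R]_d) : Prop :=
  random_vector Z /\
  exists s : nat -> step_code R d m,
    [/\ forall k p, p \in s k -> [/\ 0 <= p.1.1, p.1.1 <= p.1.2 & p.1.2 <= t],
        (\int[lebesgue_measure]_(u in `[0%R, t]%classic)
           (frobenius_sq (f u - step_fun (s k) u))%:E)%E @[k --> \oo] --> 0%E
      & (\int[P]_w (enorm (Z w - step_integral W (s k) w) ^+ 2)%:E)%E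
          @[k --> \oo] --> 0%E].

(* ------------------------------------------------------------------------ *)
(* The model dX(t) = b(t) dt + sigma(t) dW(t), t in [0,1]                   *)
(* ------------------------------------------------------------------------ *)

Record drift_process (disp : measure_display) (Omega : measurableType disp)
    (R : realType) (P : probability Omega R) (F : R -> set (set Omega))
    (d : nat) (b : R -> Omega -> 'cV[R]_d) : Prop := {
  drift_adapted : adapted F `[0, 1]%classic b;
  drift_measurable : forall i,
    measurable_fun (`[0 : R, 1 : R]%classic `*` [set: Omega])
      (fun z : R * Omega => b z.1 z.2 i 0);
  drift_integrable :
    (\int[P]_w \int[lebesgue_measure]_(t in `[0%R, 1%R]%classic)
       (enorm (b t w))%:E < +oo)%E }.

Record volatility (R : realType) (d m : nat) (sigma : R -> 'M[R]_(d, m)) :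
    Prop := {
  volatility_measurable : forall i j,
    measurable_fun `[0 : R, 1 : R]%classic (fun t => sigma t i j);
  volatility_square_integrable :
    (\int[lebesgue_measure]_(t in `[0%R, 1%R]%classic)
       (\tr (sigma t *m (sigma t)^T))%:E < +oo)%E }.

Definition int_drift (Omega : Type) (R : realType) (d : nat)
    (b : R -> Omega -> 'cV[R]_d) (t : R) (w : Omega) : 'cV[R]_d :=
  \col_i Rintegral lebesgue_measure `[0, t]%classic (fun u => b u w i 0).

(* The initial value X(0) is an arbitrary random vector. *)
Record ito_process (disp : measure_display) (Omega : measurableType disp)
    (R : realType) (P : probability Omega R) (F : R -> set (set Omega))
    (d m : nat) (W : R -> Omega -> 'cV[R]_m) (b : R -> Omega -> 'cV[R]_d)
    (sigma : R -> 'M[R]_(d, m)) (X : R -> Omega -> 'cV[R]_d) : Prop := {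
  ito_drift : drift_process P F b;
  ito_volatility : volatility sigma;
  ito_measurable : forall t : R, 0 <= t <= 1 -> random_vector (X t);
  ito_equation : forall t : R, 0 <= t <= 1 ->
    exists2 Z, is_stochastic_integral P W sigma t Z &
      {ae P, forall w, X t w = X 0 w + int_drift b t w + Z w} }.

(* ------------------------------------------------------------------------ *)
(* Estimator and test                                                       *)
(* ------------------------------------------------------------------------ *)

(* Both are used only when n h and h^-1 are natural numbers. *)
Definition block_size (R : realType) (n : nat) (h : R) : nat :=
  Num.truncn (n%:R * h).
Definition nb_blocks (R : realType) (h : R) : nat := Num.truncn h^-1.

Definition block_incr (Omega : Type) (R : realType) (d n : nat) (h : R)
    (X : R -> Omega -> 'cV[R]_d) (i k : nat) (w : Omega) : 'cV[R]_d :=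
  X (k%:R * h + i%:R / n%:R) w - X (k%:R * h + (i%:R - 1) / n%:R) w.

Definition mean_incr (Omega : Type) (R : realType) (d n : nat) (h : R)
    (X : R -> Omega -> 'cV[R]_d) (k : nat) (w : Omega) : 'cV[R]_d :=
  (n%:R * h)^-1 *:
    \sum_(1 <= j < (block_size n h).+1) block_incr n h X j k w.

Definition Sigma_hat (Omega : Type) (R : realType) (d n : nat) (h : R)
    (X : R -> Omega -> 'cV[R]_d) (k : nat) (w : Omega) : 'M[R]_d :=
  h^-1 *: \sum_(1 <= i < (block_size n h).+1)
            outer (block_incr n h X i k w - mean_incr n h X k w).

Definition test_stat (Omega : Type) (R : realType) (d n : nat) (h : R) (r : nat)
    (X : R -> Omega -> 'cV[R]_d) (w : Omega) : R :=
  \sum_(k < nb_blocks h) h * lambda r.+1 (Sigma_hat n h X k w).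

Definition test (Omega : Type) (R : realType) (d n : nat) (h : R) (r : nat)
    (kappa : R) (X : R -> Omega -> 'cV[R]_d) (w : Omega) : R :=
  \1_[set w' | kappa < test_stat n h r X w'] w.

(* ------------------------------------------------------------------------ *)
(* Function classes and hypotheses                                          *)
(* ------------------------------------------------------------------------ *)

Definition holder_cov (R : realType) (d : nat) (beta L : R) :
    set (R -> 'M[R]_d) :=
  [set Sigma | (forall t : R, 0 <= t <= 1 -> spd (Sigma t)) /\
     forall s t : R, 0 <= s <= 1 -> 0 <= t <= 1 ->
       spectral_norm (Sigma t - Sigma s) <= L * `|t - s| `^ beta].

Definition holder_drift (disp : measure_display) (Omega : measurableType disp)
    (R : realType) (P : probability Omega R) (F : R -> set (set Omega))
    (d : nat) (beta L : R) : set (R -> Omega -> 'cV[R]_d) :=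
  [set b | drift_process P F b /\
     forall s t : R, 0 <= t -> t <= s -> s <= 1 ->
       ((\int[P]_w (enorm (b s w - b t w) ^+ 4)%:E) `^ (4^-1)
          <= (L * `|s - t| `^ beta)%:E)%E].

Definition H0 (disp : measure_display) (Omega : measurableType disp)
    (R : realType) (P : probability Omega R) (F : R -> set (set Omega))
    (d r : nat) (beta_b beta_S L_b L_S : R) :
    set ((R -> 'M[R]_d) * (R -> Omega -> 'cV[R]_d)) :=
  [set Sb : (R -> 'M[R]_d) * (R -> Omega -> 'cV[R]_d) |
    [/\ {within `[0 : R, 1 : R]%classic, continuous Sb.1},
                holder_drift P F beta_b L_b Sb.2,
                forall t : R, 0 <= t <= 1 -> (\rank (Sb.1 t) <= r)%N
              & holder_cov beta_S L_S Sb.1]].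

Definition H0_gap (disp : measure_display) (Omega : measurableType disp)
    (R : realType) (P : probability Omega R) (F : R -> set (set Omega))
    (d r : nat) (beta_b beta_S L_b L_S lam : R) :
    set ((R -> 'M[R]_d) * (R -> Omega -> 'cV[R]_d)) :=
  [set Sb : (R -> 'M[R]_d) * (R -> Omega -> 'cV[R]_d) |
    H0 P F r beta_b beta_S L_b L_S Sb /\
     ((0 < r)%N -> forall t : R, 0 <= t <= 1 -> lam <= lambda r (Sb.1 t))].

(* The values P_(Sigma,b)(phi = 1) for (Sigma, b) in the class [C].  As Sigma
   does not determine sigma (nor X(0)), every sigma with sigma sigma^T = Sigma
   and every X solving the equation contributes. *)
Definition rejection_probs (disp : measure_display)
    (Omega : measurableType disp) (R : realType) (P : probability Omega R)
    (F : R -> set (set Omega)) (d m : nat) (W : R -> Omega -> 'cV[R]_m)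
    (n : nat) (h : R) (r : nat) (kappa : R)
    (C : set ((R -> 'M[R]_d) * (R -> Omega -> 'cV[R]_d))) : set (\bar R) :=
  [set p | exists (Sigma : R -> 'M[R]_d) (b : R -> Omega -> 'cV[R]_d)
                  (sigma : R -> 'M[R]_(d, m)) (X : R -> Omega -> 'cV[R]_d),
     [/\ C (Sigma, b),
         forall t : R, 0 <= t <= 1 -> Sigma t = sigma t *m (sigma t)^T,
         ito_process P F W b sigma X
       & p = P [set w | test n h r kappa X w = 1]]].

Definition kappa_nogap (R : realType) (n : nat)
    (h beta_b beta_S L_b L_S c1 c2 alpha : R) : R :=
  h `^ beta_S * (c1 * L_S + c2 * L_b ^+ 2 * n%:R^-1 * h `^ beta_b) * alpha^-1.

Definition kappa_gap (R : realType) (n : nat)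
    (h beta_S L_b L_S lam c1 c2 alpha : R) : R :=
  h `^ (2 * beta_S) * (c1 * lam^-1 * L_S ^+ 2 + c2 * L_b ^+ 2 * n%:R^-1)
    * alpha^-1.

(* Main.v *)
Require Import Defs.
From mathcomp Require Import measurable_realfun spectral complex ring lra.
Set Implicit Arguments.
Unset Strict Implicit.
Unset Printing Implicit Defensive.

(** The stochastic integral is given only as an L^2 limit of step integrals, and the approximating
    codes at two different times are unrelated. The variance of an increment is therefore read off
    the difference of two codes, whose intervals may overlap arbitrarily. No common refinement is
    needed: [min s t] is both the covariance of Brownian motion and the inner product of the
    indicators of []0, s]] and []0, t]], so both sides of the isometry are the same quadratic form
    in the endpoints. A second obstacle is measurability. Ordered eigenvalues are defined through
    the roots of a characteristic polynomial, so the rejection event is not visibly an event; this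
    is settled by Lipschitz dependence on the entries and rounding to a countable grid. The constant
    8 is a product of three factors 2, one for each separation: drift from martingale part, limit
    from step integral, step function from [sigma]. One factor d comes from summing over the vectors
    u_j, and the second one in c2 from bounding the drift coordinate by coordinate. *)

(** Markov's inequality reduces both claims to a bound on the expectation of
    the statistic, block by block.  On the block starting at [s = k h], let
    [u_r, ..., u_(d-1)] be orthonormal eigenvectors of [Sigma s] for the
    eigenvalue 0.  The positive semi-definite estimator satisfies
    [lambda_(r+1) <= sum_(j >= r) u_j^T Sigma_hat u_j], so it suffices to bound
    the expected quadratic variation of the scalar process [u_j^T X].
    Replacing the empirical mean by [b(s) / n] only increases the sum of
    squares and removes the drift up to its Hölder increments; the martingale
    part contributes at most [sup u_j^T Sigma(t) u_j] over the block.  As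
    [Sigma s u_j = 0], this is at most [L_S h^beta_S].  With a gap, all nonzero
    eigenvalues of [Sigma t] are at least [lam], hence
    [lam u^T Sigma(t) u <= |Sigma(t) u|^2 = |(Sigma(t) - Sigma(s)) u|^2], which
    is quadratic in the increment of [Sigma].  All constants are obtained from
    [(a + b)^2 <= 2 a^2 + 2 b^2]; no effort is made to optimise them. *)

(** * Spectral theorem for real symmetric matrices *)

Lemma char_poly_conj (F : comNzRingType) n (P Q A : 'M[F]_n) :
  P *m Q = 1%:M -> char_poly (P *m A *m Q) = char_poly A.
Proof.
move=> PQ; rewrite /char_poly.
have -> : char_poly_mx (P *m A *m Q) =
    map_mx polyC P *m char_poly_mx A *m map_mx polyC Q.
  rewrite /char_poly_mx mulmxBr mulmxBl !map_mxM /=; congr (_ - _).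
  by rewrite scalar_mxC -mulmxA -map_mxM PQ map_mx1 mulmx1.
rewrite !det_mulmx mulrAC -det_mulmx -map_mxM PQ map_mx1.
by rewrite det1 mul1r.
Qed.

Lemma char_poly_block_diag (F : comNzRingType) n (a : F) (A : 'M[F]_n) :
  char_poly (block_mx a%:M 0 0 A : 'M[F]_(1 + n)) = ('X - a%:P) * char_poly A.
Proof.
rewrite /char_poly /char_poly_mx map_block_mx /= !map_mx0 map_scalar_mx /=.
rewrite (scalar_mx_block 1 n) opp_block_mx add_block_mx !oppr0 !addr0.
rewrite det_ublock; congr (_ * _).
by rewrite det_mx11 !mxE !mulr1n.
Qed.

Lemma dot_row (F : pzRingType) n (u v : 'rV[F]_n) :
  (u *m v^T) 0 0 = \sum_i u 0 i * v 0 i.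
Proof. by rewrite mxE; apply: eq_bigr => i _; rewrite mxE. Qed.

Lemma dot_ge0 (F : realDomainType) n (u : 'rV[F]_n) : 0 <= (u *m u^T) 0 0.
Proof. by rewrite dot_row sumr_ge0 // => i _; rewrite -expr2 sqr_ge0. Qed.

Lemma dot_eq0 (F : realDomainType) n (u : 'rV[F]_n) :
  ((u *m u^T) 0 0 == 0) = (u == 0).
Proof.
apply/idP/eqP => [|->]; last by rewrite mul0mx mxE.
rewrite dot_row psumr_eq0 => [/allP u0|i _]; last by rewrite -expr2 sqr_ge0.
apply/rowP => i; have := u0 i (mem_index_enum _).
by rewrite -expr2 sqrf_eq0 mxE => /eqP.
Qed.

(* The reflection exchanging the two unit vectors [delta_mx 0 0] and [v]. *)
Lemma householder (F : realFieldType) n (v : 'rV[F]_(1 + n)) :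
  (v *m v^T) 0 0 = 1 ->
  exists H : 'M[F]_(1 + n),
    [/\ H^T = H, H *m H = 1%:M & v = row_mx 1%:M 0 *m H].
Proof.
move=> v1; set e : 'rV[F]_(1 + n) := row_mx 1%:M 0.
have e1 : (e *m e^T) 0 0 = 1.
  by rewrite /e tr_row_mx mul_row_col trmx1 mulmx1 mul0mx addr0 mxE.
have [->|ve] := eqVneq v e.
  by exists 1%:M; rewrite trmx1 !mulmx1.
set w := v - e; set q := (w *m w^T) 0 0.
have q0 : q != 0 by rewrite /q dot_eq0 subr_eq0.
have evC : (v *m e^T) 0 0 = (e *m v^T) 0 0.
  by rewrite !dot_row; apply: eq_bigr => i _; rewrite mulrC.
have qE : q = 2 - 2 * (e *m v^T) 0 0.
  rewrite /q /w linearB /= mulmxBl !mulmxBr !mxE in v1 e1 evC *.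
  rewrite v1 e1 evC; ring.
have wwE : w *m w^T = q%:M by rewrite [LHS]mx11_scalar.
(* This is the reflection in the hyperplane orthogonal to [w = v - e]. Since
   [2 * ((e *m v^T) 0 0 - 1) = - q], it sends [e] to [e + w = v]. *)
exists (1%:M - (2 / q) *: (w^T *m w)); split.
- by rewrite linearB /= linearZ /= trmx_mul trmxK trmx1.
- have : (w^T *m w) *m (w^T *m w) = q *: (w^T *m w).
    by rewrite mulmxA -(mulmxA w^T) wwE mul_mx_scalar -scalemxAl.
  move: (w^T *m w) => M MM.
  rewrite mulmxBl !mulmxBr !mul1mx mulmx1 -scalemxAl -scalemxAr MM !scalerA.
  rewrite -addrA -[RHS]addr0; congr (_ + _).
  rewrite opprB addrCA -opprD -scalerDl -scalerBl.
  have -> : 2 / q * (2 / q) * q - (2 / q + 2 / q) = 0 by field.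
  by rewrite scale0r.
- rewrite mulmxBr mulmx1 -scalemxAr mulmxA.
  have -> : e *m w^T = ((e *m v^T) 0 0 - 1)%:M.
    rewrite [LHS]mx11_scalar; congr _%:M.
    by rewrite linearB /= mulmxBr mxE [X in _ + X]mxE e1.
  rewrite mul_scalar_mx scalerA.
  have -> : 2 / q * ((e *m v^T) 0 0 - 1) = -1.
    by apply: (mulfI q0); rewrite mulrA mulrCA divff // qE; ring.
  by rewrite scaleN1r opprK /w addrC subrK.
Qed.

(** Deflation: a unit eigenvector for the head of [s] is moved to the first basis vector by a
    reflection, which splits off a 1 x 1 block, and cancelling ['X - a%:P] leaves the tail of [s]
    for the induction. The diagonal thus follows the order of the given list, so a sorted list
    yields an ordered diagonalization. *)
Lemma spectral_of_roots (F : rcfType) n (A : 'M[F]_n) (s : seq F) :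
  A^T = A -> char_poly A = \prod_(x <- s) ('X - x%:P) ->
  exists U : 'M[F]_n, U *m U^T = 1%:M /\
    A = U^T *m diag_mx (\row_i s`_i) *m U.
Proof.
elim: n A s => [|n IH] A s sA cA.
  by exists 0; split; apply/matrixP => -[].
case: s cA => [|a s] cA.
  by have := size_char_poly A; rewrite cA big_nil size_poly1.
have : eigenvalue A a by rewrite eigenvalue_root_char cA root_prod_XsubC mem_head.
move=> /eigenvalueP [v0 v0A v0N].
have q0 : 0 < (v0 *m v0^T) 0 0 by rewrite lt_neqAle dot_ge0 eq_sym dot_eq0 v0N.
pose v : 'rV[F]_(1 + n) := (Num.sqrt ((v0 *m v0^T) 0 0))^-1 *: v0.
have vA : v *m A = a *: v by rewrite -scalemxAl v0A !scalerA mulrC.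
have v1 : (v *m v^T) 0 0 = 1.
  rewrite linearZ /= -scalemxAl -scalemxAr scalerA mxE -invfM -expr2.
  by rewrite sqr_sqrtr ?ltW // mulVf // gt_eqF.
have [H [sH HH vH]] := householder v1.
pose B : 'M[F]_(1 + n) := H *m A *m H.
have sB : B^T = B by rewrite /B !trmx_mul sH sA mulmxA.
have eB : row_mx 1%:M 0 *m B = a *: row_mx 1%:M 0.
  rewrite /B !mulmxA -vH vA -scalemxAl vH -mulmxA HH mulmx1 //.
(* The eigenvector relation determines the first row of [B], and symmetry then clears the first
   column. *)
have BE : B = block_mx a%:M 0 0 (drsubmx B).
  move: eB; rewrite -[in X in X -> _](submxK B) mul_row_block !mul1mx !mul0mx !addr0.
  rewrite scale_row_mx scaler0 => /eq_row_mx [ulB urB].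
  rewrite -[LHS](submxK B); congr block_mx => //.
    by rewrite ulB scalemx1.
  by rewrite -sB -trmx_ursub urB trmx0.
have sD : (drsubmx B)^T = drsubmx B by rewrite -[in RHS]sB trmx_drsub.
have cB : char_poly (drsubmx B) = \prod_(x <- s) ('X - x%:P).
  have : char_poly B = char_poly A by rewrite char_poly_conj.
  rewrite {1}BE char_poly_block_diag cA big_cons; apply: mulfI.
  by rewrite polyXsubC_eq0.
have [U [UU UE]] := IH _ _ sD cB.
pose G : 'M[F]_(1 + n) := block_mx 1%:M 0 0 U.
have GT : G^T = block_mx 1%:M 0 0 U^T by rewrite tr_block_mx trmx1 !trmx0.
have GG : G *m G^T = 1%:M.
  rewrite GT /G mulmx_block !mulmx0 !mul0mx !addr0 !add0r UU mulmx1.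
  by rewrite -scalar_mx_block.
pose D : 'M[F]_(1 + n) := diag_mx (\row_i (a :: s)`_i).
have DE : D = block_mx a%:M 0 0 (diag_mx (\row_i s`_i)).
  rewrite /D; have -> : \row_(i < n.+1) (a :: s)`_i = row_mx a%:M (\row_i s`_i) :> 'rV[F]_(1 + n).
    apply/rowP => i; rewrite !mxE; case: splitP => j /= ->.
      by rewrite (ord1 j) !mxE mulr1n.
    by rewrite mxE.
  rewrite diag_mx_row; congr block_mx.
  by apply/matrixP => i j; rewrite !ord1 !mxE mulr1n.
have BG : B = G^T *m D *m G.
  rewrite {1}BE UE GT DE /G !mulmx_block !mulmx0 !mul0mx !mulmx1 !mul1mx.
  by rewrite !addr0 !add0r !mul0mx.
exists (G *m H); split.
  by rewrite trmx_mul sH mulmxA -(mulmxA G) HH mulmx1.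
transitivity (H *m B *m H).
  by rewrite /B !mulmxA HH mul1mx -mulmxA HH mulmx1.
by rewrite BG trmx_mul sH !mulmxA.
Qed.

(** Over the complex closure [A] is Hermitian, hence unitarily diagonalizable with real diagonal.
    The factorization descends because the embedding is injective on polynomials. *)
Lemma symmetric_real_roots (F : rcfType) n (A : 'M[F]_n) : A^T = A ->
  exists s : seq F, char_poly A = \prod_(x <- s) ('X - x%:P).
Proof.
move=> sA; pose f := real_complex F.
pose B := map_mx f A.
have hB : B \is hermsymmx.
  apply: realsym_hermsym.
    by apply/is_hermitianmxP; rewrite expr0 scale1r map_mx_id // /B map_trmx sA.
  by apply/mxOverP => i j; rewrite mxE; apply/complex_realP; eexists.
have /orthomx_spectralP BE := hermitian_normalmx hB.
have rD := hermitian_spectral_diag_real hB.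
exists [seq complex.Re (spectral_diag B 0 i) | i <- enum 'I_n].
apply: (map_poly_inj f).
rewrite rmorph_prod /= big_map big_enum /=.
rewrite map_char_poly -/B [in LHS]BE char_poly_conj ?mulVmx ?spectral_unit //.
rewrite char_poly_trig ?diag_mx_is_trig //; apply: eq_bigr => i _.
rewrite rmorphB /= map_polyX map_polyC /= mxE eqxx mulr1n; congr (_ - _%:P).
by rewrite /f RRe_real //; move/mxOverP: rD; apply.
Qed.

Lemma symmetric_spectral (F : rcfType) n (A : 'M[F]_n) : A^T = A ->
  exists s : seq F, sorted >=%R s /\ char_poly A = \prod_(x <- s) ('X - x%:P).
Proof.
move=> /symmetric_real_roots [s cA]; exists (sort >=%R s); split.
  by apply: sort_sorted => x y; rewrite orbC le_total.
by rewrite cA; apply: perm_big; rewrite perm_sym perm_sort.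
Qed.

(** * Ordered eigenvalues *)

Definition qform (R : comPzRingType) n (A : 'M[R]_n) (x : 'cV[R]_n) : R :=
  (x^T *m A *m x) 0 0.

Lemma mulmx_col (R : pzRingType) m n p (A : 'M[R]_(m, n)) (B : 'M[R]_(n, p)) j :
  A *m col j B = col j (A *m B).
Proof. by rewrite !colE mulmxA. Qed.

Lemma eigenvaluesP (R : realType) d (A : 'M[R]_d) : A^T = A ->
  sorted >=%R (eigenvalues A) /\
  char_poly A = \prod_(x <- eigenvalues A) ('X - x%:P).
Proof.
move=> /symmetric_spectral sp.
exact: (@xgetPex _ [::] [set s : seq R | sorted >=%R s /\
                             char_poly A = \prod_(x <- s) ('X - x%:P)]).
Qed.

Lemma size_eigenvalues (R : realType) d (A : 'M[R]_d) : A^T = A ->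
  size (eigenvalues A) = d.
Proof.
move=> /eigenvaluesP[_ cA]; apply: succn_inj.
by rewrite -(size_prod_XsubC _ id) -cA size_char_poly.
Qed.

Lemma eigenvalues_nincr (R : realType) d (A : 'M[R]_d) i j : A^T = A ->
  (i <= j < d)%N -> (eigenvalues A)`_j <= (eigenvalues A)`_i.
Proof.
move=> sA /andP[ij jd]; have [so _] := eigenvaluesP sA.
have sz := size_eigenvalues sA.
apply: (sorted_leq_nth _ _ _ so) => //; rewrite ?inE ?sz //; last exact: leq_ltn_trans jd.
  by move=> y x z xy yz; apply: le_trans yz xy.
exact: lexx.
Qed.

(** Convention for the sequel: the eigenvectors are the rows of [U], so [U *m x] lists the
    coordinates of [x] in the ordered eigenbasis. *)
Lemma eigen_decomp (R : realType) d (A : 'M[R]_d) : A^T = A ->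
  exists U : 'M[R]_d, [/\ U *m U^T = 1%:M, U^T *m U = 1%:M &
    A = U^T *m diag_mx (\row_i (eigenvalues A)`_i) *m U].
Proof.
move=> sA; have [_ cA] := eigenvaluesP sA.
have [U [UU AE]] := spectral_of_roots sA cA.
by exists U; split => //; apply: mulmx1C.
Qed.

Lemma qform_diag (R : comPzRingType) d (s : 'rV[R]_d) (x : 'cV[R]_d) :
  qform (diag_mx s) x = \sum_i s 0 i * x i 0 ^+ 2.
Proof.
rewrite /qform -mulmxA mul_diag_mx !mxE; apply: eq_bigr => i _.
by rewrite !mxE; ring.
Qed.

Lemma qform_conj (R : comPzRingType) d (U A : 'M[R]_d) (x : 'cV[R]_d) :
  qform (U^T *m A *m U) x = qform A (U *m x).
Proof. by rewrite /qform trmx_mul !mulmxA. Qed.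

Lemma qform_id (R : comPzRingType) d (x : 'cV[R]_d) :
  qform 1%:M x = \sum_i x i 0 ^+ 2.
Proof.
rewrite /qform mulmx1 mxE; apply: eq_bigr => i _.
by rewrite !mxE expr2.
Qed.

Lemma qform_orthogonal (R : comPzRingType) d (U : 'M[R]_d) (x : 'cV[R]_d) :
  U^T *m U = 1%:M -> \sum_i (U *m x) i 0 ^+ 2 = \sum_i x i 0 ^+ 2.
Proof. by move=> UU; rewrite -!qform_id -qform_conj mulmx1 UU. Qed.

Lemma sum_row_orthogonal (R : comPzRingType) d (M : 'M[R]_d) i :
  M *m M^T = 1%:M -> \sum_j M i j ^+ 2 = 1.
Proof.
move=> /matrixP/(_ i i); rewrite !mxE eqxx mulr1n => <-.
by apply: eq_bigr => j _; rewrite mxE expr2.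
Qed.

(** For the orthogonal matrix [M = U *m V] the squares of the entries have row and column sums 1.
    The first r + 1 rows carry mass r + 1, and the r columns outside [J] can absorb at most r of it.
    Mass at least 1 is left on [I] times [J], where every eigenvalue involved is at least the
    (r+1)-th one; the other terms on the right are nonnegative. *)
Lemma lambda_le_sum (R : realType) d (A V : 'M[R]_d) (r : nat) :
  spd A -> V^T *m V = 1%:M -> (r < d)%N ->
  lambda r.+1 A <= \sum_(j < d | (r <= j)%N) qform A (col j V).
Proof.
move=> [sA pA] VV rd; have [U [UU UU' AE]] := eigen_decomp sA.
set s := eigenvalues A; pose M := U *m V.
have VV' := mulmx1C VV.
have MM : M *m M^T = 1%:M by rewrite trmx_mul mulmxA -(mulmxA U) VV' mulmx1.
have MM' := mulmx1C MM.
have qE x : qform A x = \sum_(i < d) s`_i * (U *m x) i 0 ^+ 2.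
  rewrite {1}AE qform_conj qform_diag; apply: eq_bigr => i _.
  by rewrite mxE.
have s0 (i : 'I_d) : 0 <= s`_i.
  have := pA (col i U^T); rewrite -/(qform _ _) qE (bigD1 i) //= big1 => [|k ki].
    by rewrite mulmx_col UU !mxE eqxx expr1n mulr1 addr0.
  by rewrite mulmx_col UU !mxE (negbTE ki) expr0n mulr0.
have qM j : qform A (col j V) = \sum_(i < d) s`_i * M i j ^+ 2.
  rewrite qE; apply: eq_bigr => i _; congr (_ * _ ^+ 2).
  by rewrite mulmx_col mxE.
pose I (i : 'I_d) := (i <= r)%N; pose J (j : 'I_d) := (r <= j)%N.
have cI : \sum_(i < d | I i) 1 = r.+1%:R :> R.
  transitivity (\sum_(i < d | (i < r.+1)%N) 1 : R); first exact: eq_bigl.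
  by rewrite (big_ord_narrow rd) sumr_const card_ord.
have cJ : \sum_(j < d | ~~ J j) 1 = r%:R :> R.
  transitivity (\sum_(i < d | (i < r)%N) 1 : R).
    by apply: eq_bigl => i; rewrite /J -ltnNge.
  by rewrite (big_ord_narrow (ltnW rd)) sumr_const card_ord.
have mass : 1 <= \sum_(i < d | I i) \sum_(j < d | J j) M i j ^+ 2.
  have E1 : \sum_(i < d | I i) \sum_(j < d | J j) M i j ^+ 2 =
      r.+1%:R - \sum_(i < d | I i) \sum_(j < d | ~~ J j) M i j ^+ 2.
    rewrite -cI -sumrB; apply: eq_bigr => i _.
    by rewrite -(sum_row_orthogonal i MM) [in RHS](bigID J) /= addrK.
  have E2 : \sum_(i < d | I i) \sum_(j < d | ~~ J j) M i j ^+ 2 <= r%:R.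
    rewrite exchange_big /= -cJ; apply: ler_sum => j _.
    rewrite -(@sum_row_orthogonal _ _ M^T j); last by rewrite trmxK.
    rewrite [leRHS](bigID I) /= -[leLHS]addr0; apply: lerD.
      by apply: ler_sum => i _; rewrite [M^T j i]mxE.
    by apply: sumr_ge0 => i _; rewrite sqr_ge0.
  by rewrite E1 lerBrDr -natr1 [leRHS]addrC lerD2l.
have sr0 : 0 <= s`_r by apply: (s0 (Ordinal rd)).
apply: (@le_trans _ _ (\sum_(i < d | I i) \sum_(j < d | J j) s`_i * M i j ^+ 2)).
  apply: (le_trans (ler_peMr sr0 mass)).
  rewrite mulr_sumr; apply: ler_sum => i ir; rewrite mulr_sumr.
  apply: ler_sum => j _; apply: ler_wpM2r; first exact: sqr_ge0.
  by apply: eigenvalues_nincr => //; apply/andP.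
rewrite exchange_big /=; apply: ler_sum => j _; rewrite qM.
rewrite [leRHS](bigID I) /= lerDl; apply: sumr_ge0 => i _.
by rewrite mulr_ge0 ?sqr_ge0.
Qed.

(* The span of the top [r + 1] eigenvectors of [A] meets the span of the
   bottom [d - r] eigenvectors of [B] because of dimensions. *)
Lemma lambda_le_shift (R : realType) d (A B : 'M[R]_d) (c : R) (r : nat) :
  A^T = A -> B^T = B -> (r < d)%N ->
  (forall x, qform A x <= qform B x + c * \sum_i x i 0 ^+ 2) ->
  lambda r.+1 A <= lambda r.+1 B + c.
Proof.
move=> sA sB rd AB.
have [U [UU UU' AE]] := eigen_decomp sA.
have [V [VV VV' BE]] := eigen_decomp sB.
set s := eigenvalues A in AE; set t := eigenvalues B in BE.
have qA x : qform A x = \sum_(i < d) s`_i * (U *m x) i 0 ^+ 2.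
  by rewrite {1}AE qform_conj qform_diag; apply: eq_bigr => i _; rewrite mxE.
have qB x : qform B x = \sum_(i < d) t`_i * (V *m x) i 0 ^+ 2.
  by rewrite {1}BE qform_conj qform_diag; apply: eq_bigr => i _; rewrite mxE.
pose M := U *m V^T.
(* [N] holds the inner products of the first r + 1 eigenvectors of [A] with the first r eigenvectors
   of [B]. Having more rows than columns, it has a nonzero left kernel vector [e], which gives a
   combination of the former orthogonal to all of the latter. *)
pose N : 'M[R]_(r.+1, r) := \matrix_(i, j) M (widen_ord rd i) (widen_ord (ltnW rd) j).
have : kermx N != 0.
  rewrite kermx_eq0 /row_free; apply/negP => /eqP E.
  by have := rank_leq_col N; rewrite E ltnn.
case/rowV0Pn => e eN e0.
have {}eN : e *m N = 0 by apply/sub_kermxP.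
pose f : 'cV[R]_d := \col_i if insub (val i) is Some k then e 0 k else 0.
have fE (k : 'I_r.+1) : f (widen_ord rd k) 0 = e 0 k.
  by rewrite mxE /= valK.
have f0 (i : 'I_d) : (r < i)%N -> f i 0 = 0.
  by move=> ri; rewrite mxE insubN // -leqNgt.
pose x := U^T *m f.
have Ux : U *m x = f by rewrite mulmxA UU mul1mx.
have Vx (j : 'I_d) : (j < r)%N -> (V *m x) j 0 = 0.
  move=> jr; have E0 : (e *m N) 0 (Ordinal jr) = 0 by rewrite eN mxE.
  rewrite mxE in E0; rewrite -[RHS]E0.
  have -> : V *m x = M^T *m f by rewrite /M trmx_mul trmxK -mulmxA.
  rewrite mxE (bigID (fun i : 'I_d => (i < r.+1)%N)) /= [X in _ + X]big1 ?addr0; last first.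
    by move=> i; rewrite -leqNgt => ri; rewrite f0 // mulr0.
  rewrite (big_ord_narrow rd) /=; apply: eq_bigr => i _.
  rewrite fE [M^T _ _]mxE [N _ _]mxE mulrC; congr (_ * M _ _).
  exact: val_inj.
have Q : \sum_i x i 0 ^+ 2 = \sum_i f i 0 ^+ 2 by rewrite -(qform_orthogonal x UU') Ux.
have Q' : \sum_i (V *m x) i 0 ^+ 2 = \sum_i f i 0 ^+ 2 by rewrite qform_orthogonal.
have Q0 : 0 < \sum_i f i 0 ^+ 2.
  rewrite lt_neqAle sumr_ge0 ?andbT => [|i _]; last exact: sqr_ge0.
  apply: contra e0; rewrite eq_sym psumr_eq0 => [/allP z|i _]; last exact: sqr_ge0.
  apply/eqP/rowP => k; rewrite -fE [RHS]mxE; apply/eqP.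
  by rewrite -sqrf_eq0; apply: z; rewrite mem_index_enum.
rewrite -(ler_pM2r Q0) mulrDl.
apply: (@le_trans _ _ (qform A x)).
  rewrite qA Ux mulr_sumr; apply: ler_sum => i _.
  have [ir|ri] := leqP i r; last by rewrite f0 // expr0n /= !mulr0.
  apply: ler_wpM2r; first exact: sqr_ge0.
  by apply: eigenvalues_nincr => //; rewrite ir.
apply: (le_trans (AB x)); rewrite Q lerD2r qB -Q' mulr_sumr.
apply: ler_sum => i _.
have [ir|ri] := ltnP i r; first by rewrite Vx // expr0n /= !mulr0.
apply: ler_wpM2r; first exact: sqr_ge0.
by apply: eigenvalues_nincr => //; rewrite ri ltn_ord.
Qed.

Lemma eigenvalues_ge0 (R : realType) d (A : 'M[R]_d) (i : nat) : spd A ->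
  0 <= (eigenvalues A)`_i.
Proof.
move=> [sA pA]; have [id|di] := ltnP i d; last first.
  by rewrite nth_default // size_eigenvalues.
have [U [UU UU' AE]] := eigen_decomp sA; pose k := Ordinal id.
have := pA (col k U^T).
rewrite -/(qform _ _) {1}AE qform_conj mulmx_col UU qform_diag (bigD1 k) //= big1 => [|j jk].
  by rewrite !mxE eqxx expr1n mulr1 addr0.
by rewrite !mxE (negbTE jk) expr0n mulr0.
Qed.

(** A nonzero eigenvalue at a position i >= r would make the first r + 1 eigenvalues positive.
    Compressing [A] to their eigenvectors gives an invertible diagonal matrix of size r + 1, which
    contradicts the rank bound. *)
Lemma eigenvalues_rank (R : realType) d (A : 'M[R]_d) (r i : nat) : spd A ->
  (\rank A <= r)%N -> (r <= i)%N -> (eigenvalues A)`_i = 0.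
Proof.
move=> pA rA ri; have sA := pA.1.
have [id|di] := ltnP i d; last by rewrite nth_default // size_eigenvalues.
apply/eqP; apply: contraTT rA => si; rewrite -ltnNge.
have [U [UU UU' AE]] := eigen_decomp sA.
pose E : 'M[R]_(r.+1, d) := \matrix_(k, j) (k == j :> nat)%:R.
have rd : (r < d)%N := leq_ltn_trans ri id.
have ED : (E *m U) *m A *m (E *m U)^T = diag_mx (\row_k (eigenvalues A)`_k).
  rewrite {1}AE trmx_mul !mulmxA -(mulmxA _ U U^T) UU mulmx1 -(mulmxA _ U U^T) UU mulmx1.
  apply/matrixP => k l; rewrite mxE (bigD1 (widen_ord rd l)) //= big1 ?addr0; last first.
    move=> j jl; rewrite [E^T _ _]mxE [E _ _]mxE (_ : l == j :> nat = false) ?mulr0 //.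
    by rewrite eq_sym; apply: contraNF jl => /eqP jl; apply/eqP/val_inj.
  rewrite mul_mx_diag !mxE eqxx mulr1 /= mulr_natl.
  have [->|kl] := eqVneq k l; first by rewrite eqxx.
  by rewrite (_ : k == l :> nat = false) //; apply: contraNF kl => /eqP kl; apply/eqP/val_inj.
have <- : \rank ((E *m U) *m A *m (E *m U)^T) = r.+1.
  apply: mxrank_unit; rewrite ED unitmxE det_diag unitfE.
  apply/prodf_neq0 => k _; rewrite mxE gt_eqF //.
  apply: (@lt_le_trans _ _ (eigenvalues A)`_i).
    by rewrite lt_neqAle eq_sym si eigenvalues_ge0.
  by apply: eigenvalues_nincr => //; rewrite id andbT (leq_trans _ ri) // -ltnS.
exact: leq_trans (mxrankM_maxl _ _) (mxrankM_maxr _ _).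
Qed.

Lemma kernel_basis (R : realType) d (A : 'M[R]_d) (r : nat) : spd A ->
  (\rank A <= r)%N ->
  exists2 V : 'M[R]_d, V^T *m V = 1%:M &
    forall j : 'I_d, (r <= j)%N -> A *m col j V = 0.
Proof.
move=> pA rA; have [U [UU UU' AE]] := eigen_decomp pA.1.
exists U^T; rewrite ?trmxK // => j rj.
rewrite {1}AE -mulmxA mulmx_col UU -mulmxA mul_diag_mx.
rewrite [X in _ *m X](_ : _ = 0) ?mulmx0 //; apply/colP => i; rewrite !mxE.
have [->|ij] := eqVneq i j; last by rewrite mulr0.
by rewrite (eigenvalues_rank pA rA rj) mul0r.
Qed.

(** In the eigenbasis this is the scalar inequality lam s <= s^2 for each eigenvalue s: the first r
    of them are at least [lam], the others vanish by the rank bound. *)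
Lemma gap_qform (R : realType) d (A : 'M[R]_d) (r : nat) (lam : R) (x : 'cV[R]_d) :
  spd A -> (\rank A <= r)%N -> ((0 < r)%N -> lam <= lambda r A) ->
  lam * qform A x <= \sum_i (A *m x) i 0 ^+ 2.
Proof.
move=> pA rA gA; have [U [UU UU' AE]] := eigen_decomp pA.1.
rewrite {1 2}AE qform_conj qform_diag -(mulmxA _ U) -(mulmxA U^T).
rewrite (qform_orthogonal _ (U := U^T)) ?trmxK // mul_diag_mx mulr_sumr.
apply: ler_sum => i _; rewrite !mxE exprMn mulrA; apply: ler_wpM2r; first exact: sqr_ge0.
have [ir|ri] := ltnP i r; last by rewrite (eigenvalues_rank pA rA ri) mulr0 expr0n.
rewrite expr2; apply: ler_wpM2r; first exact: eigenvalues_ge0.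
have r0 : (0 < r)%N by case: r ir {rA gA}.
(* If r exceeds d, then [lambda r A] is the default value 0 of [nth], and the gap hypothesis forces
   [lam <= 0]. *)
have [rd|dr] := leqP r d; last first.
  apply: (le_trans (gA r0)); rewrite /lambda nth_default ?eigenvalues_ge0 //.
  by rewrite size_eigenvalues ?pA.1 // -ltnS prednK.
apply: (le_trans (gA r0)); apply: eigenvalues_nincr; first exact: pA.1.
by rewrite -ltnS prednK // ir.
Qed.

(** * Norms, perturbation bounds and measurability of eigenvalues *)

Lemma sqr_enorm (R : realType) d (x : 'cV[R]_d) : enorm x ^+ 2 = \sum_i x i 0 ^+ 2.
Proof. by rewrite sqr_sqrtr // sumr_ge0 // => i _; exact: sqr_ge0. Qed.

(** A [sup] dominates its set only if the set is bounded. The bound used: on the unit ball, each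
    coordinate of [A *m y] is at most the sum of the absolute values in the corresponding row. *)
Lemma spectral_norm_ub (R : realType) d (A : 'M[R]_d) (x : 'cV[R]_d) :
  enorm x <= 1 -> enorm (A *m x) <= spectral_norm A.
Proof.
move=> x1; apply: ub_le_sup; last by exists x.
exists (Num.sqrt (\sum_i (\sum_j `|A i j|) ^+ 2)) => _ [y /= y1 <-].
rewrite /enorm ler_sqrt ?sumr_ge0 // => [|i _]; last exact: sqr_ge0.
apply: ler_sum => i _; rewrite -real_normK ?num_real //.
apply: lerXn2r; rewrite ?nnegrE ?sumr_ge0 //.
rewrite mxE; apply: (le_trans (ler_norm_sum _ _ _)); apply: ler_sum => j _.
rewrite normrM ler_piMr //; apply: le_trans y1.
rewrite -sqrtr_sqr ler_sqrt ?sumr_ge0 // => [|k _]; last exact: sqr_ge0.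
by rewrite (bigD1 j) //= lerDl sumr_ge0 // => k _; exact: sqr_ge0.
Qed.

Lemma qformB (R : comPzRingType) d (A B : 'M[R]_d) x :
  qform (A - B) x = qform A x - qform B x.
Proof. by rewrite /qform mulmxBr mulmxBl !mxE. Qed.

Lemma qformE (R : comPzRingType) d (A : 'M[R]_d) (x : 'cV[R]_d) :
  qform A x = \sum_i \sum_j x i 0 * A i j * x j 0.
Proof.
rewrite /qform -mulmxA mxE; apply: eq_bigr => i _.
by rewrite !mxE mulr_sumr; apply: eq_bigr => j _; rewrite mulrA.
Qed.

(** Each product |x_i x_j| is at most half of x_i^2 + x_j^2. Combined with [lambda_le_shift], this
    makes every ordered eigenvalue Lipschitz, with constant d, in the largest entry of a symmetric
    perturbation. *)
Lemma qform_entries_le (R : realType) d (A : 'M[R]_d) (x : 'cV[R]_d) (e : R) :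
  (forall i j, `|A i j| <= e) -> qform A x <= d%:R * e * \sum_i x i 0 ^+ 2.
Proof.
move=> Ae; rewrite qformE.
apply: (@le_trans _ _ (\sum_i \sum_j (e / 2 * x i 0 ^+ 2 + e / 2 * x j 0 ^+ 2))).
  apply: ler_sum => i _; apply: ler_sum => j _.
  apply: (le_trans (ler_norm _)); rewrite !normrM.
  apply: (@le_trans _ _ (e * (`|x i 0| * `|x j 0|))).
    by rewrite mulrAC mulrC; apply: ler_wpM2r; rewrite ?mulr_ge0.
  have e0 : 0 <= e by apply: le_trans (Ae i j).
  rewrite -mulrDr -mulrA ler_wpM2l // -(real_normK (num_real (x i 0))) -(real_normK (num_real (x j 0))).
  by have := sqr_ge0 (`|x i 0| - `|x j 0|); nra.
under eq_bigr do rewrite big_split /= sumr_const card_ord -mulr_sumr.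
rewrite big_split /= sumr_const card_ord sumrMnl -mulr_sumr.
by rewrite -mulrnDl -mulrDl -splitr -[_ *+ d]mulr_natl mulrA.
Qed.

(** A preimage under [g \o Z] is a countable union of fibres of [Z], whatever [g] is. So [g] may
    involve [lambda] before anything is known about its regularity. *)
Lemma measurable_countable_comp d (T : measurableType d) (R : realType)
    (U : countType) (Z : T -> U) (g : U -> R) :
  (forall u, measurable (Z @^-1` [set u])) -> measurable_fun setT (g \o Z).
Proof.
move=> mZ _ B mB; rewrite setTI.
rewrite (_ : _ @^-1` B = \bigcup_u (if g u \in B then Z @^-1` [set u] else set0)).
  apply: countable_bigcupT_measurable; first exact: countableP.
  by move=> u; case: ifP.
apply/seteqP; split => [w Bw|w [u _]] /=.
  by exists (Z w) => //; rewrite mem_set.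
by case: ifP => // /set_mem Bu ->.
Qed.

(** Rounding the entries down to multiples of 1/(N+1) gives a matrix with countably many values,
    still symmetric since rounding acts entry by entry. By the Lipschitz bound its eigenvalue is
    within d/(N+1) of the original one, so [lambda] is a pointwise limit of measurable functions. *)
Lemma measurable_lambda dp (T : measurableType dp) (R : realType) d (r : nat)
    (A : T -> 'M[R]_d) : (r < d)%N -> (forall w, (A w)^T = A w) ->
  (forall i j, measurable_fun setT (fun w => A w i j)) ->
  measurable_fun setT (fun w => lambda r.+1 (A w)).
Proof.
move=> rd sA mA.
pose Z N w : 'M[int]_d := \matrix_(i, j) Num.floor (N.+1%:R * A w i j).
pose G N (M : 'M[int]_d) : 'M[R]_d := \matrix_(i, j) ((M i j)%:~R / N.+1%:R).
have sG N w : (G N (Z N w))^T = G N (Z N w).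
  by apply/matrixP => i j; rewrite !mxE -{1}(sA w) mxE.
have GA N w i j : `|G N (Z N w) i j - A w i j| <= N.+1%:R^-1.
  have N0 : 0 < N.+1%:R :> R by [].
  rewrite !mxE; have /andP[] := floor_itv (N.+1%:R * A w i j).
  rewrite intrD mulr1z; move: (N.+1%:R) (_%:~R) N0 => K f K0 f1 f2.
  rewrite -(ler_pM2r K0) mulVf ?gt_eqF // -{2}(gtr0_norm K0) -normrM mulrBl.
  by rewrite divfK ?gt_eqF // [_ * K]mulrC ler_norml; apply/andP; split; lra.
apply: (measurable_fun_cvg (h := fun N w => lambda r.+1 (G N (Z N w)))).
  move=> N; apply: (@measurable_countable_comp _ _ _ _ (Z N) (fun M => lambda r.+1 (G N M))).
  move=> M; rewrite (_ : _ @^-1` _ = \bigcap_(k in [set: 'I_d * 'I_d])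
      [set w | (M k.1 k.2)%:~R <= N.+1%:R * A w k.1 k.2 < (M k.1 k.2 + 1)%:~R]).
    apply: fin_bigcap_measurable => // k _.
    rewrite -[X in measurable X]setTI.
    have mk : measurable_fun setT (fun w => N.+1%:R * A w k.1 k.2).
      by apply: measurable_funM => //; exact: mA.
    rewrite (_ : [set _ | _] = (fun w => N.+1%:R * A w k.1 k.2) @^-1` `[(M k.1 k.2)%:~R, (M k.1 k.2 + 1)%:~R[%classic).
      exact: mk.
    by apply/seteqP; split => w; rewrite /= in_itv.
  apply/seteqP; split => [w <- k _|w H] /=; first by rewrite mxE floor_itv.
  by apply/matrixP => i j; rewrite mxE; apply: floor_def; apply: (H (i, j)).
move=> w _; apply/cvgrPdist_le => e e0.
have : (d%:R * harmonic n) @[n --> \oo] --> (d%:R * 0 : R).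
  by apply: cvgM; [exact: cvg_cst | exact: cvg_harmonic].
rewrite mulr0 => /cvgr0_norm_le /(_ _ e0); apply: filterS => N.
rewrite ger0_norm ?mulr_ge0 ?harmonic_ge0 // => he; apply: le_trans he.
rewrite ler_norml; apply/andP; split.
  rewrite lerNl opprB lerBlDl; apply: lambda_le_shift => // x.
  rewrite -lerBlDl -qformB; apply: qform_entries_le => i j.
  by rewrite !mxE; have := GA N w i j; rewrite !mxE.
rewrite lerBlDl; apply: lambda_le_shift => // x.
rewrite -lerBlDl -qformB; apply: qform_entries_le => i j.
by rewrite mxE [X in _ + X]mxE distrC; apply: GA.
Qed.

(** * Gaussian moments and Brownian covariances *)

(** The Radon-Nikodym derivative of [normal_prob] and [normal_pdf] have the same integral over every
    measurable set, hence agree almost everywhere. *)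
Lemma integral_normal_prob (R : realType) (m s : R) (f : R -> \bar R) :
  (forall x, (0 <= f x)%E) -> measurable_fun setT f ->
  (\int[normal_prob m s]_x f x =
   \int[lebesgue_measure]_x (f x * (normal_pdf m s x)%:E))%E.
Proof.
move=> f0 mf; have dom := @normal_prob_dominates R m s.
rewrite -(Radon_Nikodym_SigmaFinite.change_of_variables dom f0 measurableT mf).
apply: ge0_ae_eq_integral => //.
- apply: emeasurable_funM => //.
  exact: measurable_int (Radon_Nikodym_SigmaFinite.f_integrable dom).
- apply: emeasurable_funM => //.
  by apply/measurable_EFinP; exact: measurable_normal_pdf.
- by move=> x _; rewrite mule_ge0 // Radon_Nikodym_SigmaFinite.f_ge0.
- by move=> x _; rewrite mule_ge0 // lee_fin normal_pdf_ge0.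
apply: ae_eqe_mul2l; apply: integral_ae_eq => //.
- exact: Radon_Nikodym_SigmaFinite.f_integrable.
- by apply/measurable_EFinP; exact: measurable_normal_pdf.
- by move=> E _ mE; rewrite -Radon_Nikodym_SigmaFinite.f_integral.
Qed.

(** Convexity of exp: its tangent at [- (t * z)] lies below the graph at 0 ([h1]) and at [- z]
    ([h2]), and the two inequalities are averaged with weights 1 - t and t. *)
Lemma expR_chord (R : realType) (t z : R) : 0 <= t <= 1 ->
  t * (1 - expR (- z)) <= 1 - expR (- (t * z)).
Proof.
move=> /andP[t0 t1]; set e := expR (- (t * z)).
have h1 : e * (1 + t * z) <= 1.
  have := expR_ge1Dx (t * z); rewrite -(ler_pM2l (expR_gt0 (- (t * z)))).
  by rewrite -expRD addNr expR0.
have h2 : e * (1 + (t * z - z)) <= expR (- z).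
  have := expR_ge1Dx (t * z - z); rewrite -(ler_pM2l (expR_gt0 (- (t * z)))).
  by rewrite -expRD; congr (_ <= expR _); ring.
have h3 : (1 - t) * (e * (1 + t * z)) <= 1 - t by rewrite ler_piMr ?subr_ge0.
have h4 : t * (e * (1 + (t * z - z))) <= t * expR (- z) by rewrite ler_wpM2l.
have E : (1 - t) * (e * (1 + t * z)) + t * (e * (1 + (t * z - z))) = e by ring.
by have := lerD h3 h4; rewrite E; lra.
Qed.

Lemma expR_quotient_nincr (R : realType) (e1 e2 y : R) : 0 < e1 -> e1 <= e2 ->
  (1 - expR (- (e2 * y))) / e2 <= (1 - expR (- (e1 * y))) / e1.
Proof.
move=> e0 e12; have e2p : 0 < e2 := lt_le_trans e0 e12.
have t01 : 0 <= e1 / e2 <= 1.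
  by rewrite divr_ge0 ?(ltW e0) ?(ltW e2p) //= ler_pdivrMr // mul1r.
have := expR_chord (e2 * y) t01; rewrite mulrA divfK ?gt_eqF // => h.
rewrite ler_pdivlMr //; apply: le_trans h.
by rewrite le_eqVlt; apply/orP; left; apply/eqP; ring.
Qed.

Lemma expR_quotient_cvg (R : realType) (e : nat -> R) (y : R) :
  (forall n, 0 < e n) -> e n @[n --> \oo] --> 0 -> 0 <= y ->
  (1 - expR (- (e n * y))) / e n @[n --> \oo] --> y.
Proof.
move=> e0 ecvg y0; apply: (@squeeze_cvgr _ _ _ _ (fun n => y - e n * y ^+ 2) (fun=> y)).
- apply: nearW => n; have en := e0 n; apply/andP; split; last first.
    rewrite ler_pdivrMr // lerBlDr addrC -lerBlDr.
    by have := expR_ge1Dx (- (e n * y)); lra.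
  rewrite ler_pdivlMr // lerBrDr addrC -lerBrDr.
  set z := e n * y; have z0 : 0 <= z by rewrite mulr_ge0 // ltW.
  have -> : 1 - (y - e n * y ^+ 2) * e n = 1 - z + z ^+ 2 by rewrite /z; ring.
  have := expR_ge1Dx z; rewrite -(ler_pM2l (expR_gt0 (- z))) -expRD addNr expR0.
  by have := expR_gt0 (- z); nra.
- rewrite -[X in _ --> X]subr0; apply: cvgB; first exact: cvg_cst.
  by rewrite -(mul0r (y ^+ 2)); apply: cvgM => //; exact: cvg_cst.
- exact: cvg_cst.
Qed.

(** A Gaussian weight only changes the variance of a centred normal density. Integrating shows that
    the mass of the weight under N(0, s^2) is [a]. *)
Lemma normal_pdf_scale (R : realType) (s a x : R) : 0 < s -> 0 < a ->
  a * normal_pdf 0 (a * s) x =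
  expR (- ((a ^- 2 - 1) / (2 * s ^+ 2) * x ^+ 2)) * normal_pdf 0 s x.
Proof.
move=> s0 a0; rewrite !normal_pdfE ?mulf_neq0 ?gt_eqF // /normal_peak /normal_fun.
have -> : (a * s) ^+ 2 * pi *+ 2 = a ^+ 2 * (s ^+ 2 * pi *+ 2) by ring.
rewrite sqrtrM ?sqr_ge0 // sqrtr_sqr gtr0_norm // invfM !mulrA divff ?gt_eqF // mul1r.
rewrite [in RHS]mulrAC -expRD mulrC; congr (expR _ * _).
by field; rewrite !gt_eqF.
Qed.

(* The mass of [exp(- e x^2)] under N(0, s^2) is explicit, and the quotients
   [(1 - exp(- e x^2)) / e] increase to [x^2] as [e] decreases to 0. *)
Lemma normal_second_moment (R : realType) (s : R) : 0 < s ->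
  (\int[normal_prob 0 s]_x (x ^+ 2)%:E = (s ^+ 2)%:E)%E.
Proof.
move=> s0; rewrite integral_normal_prob; last 2 first.
- by move=> x; rewrite lee_fin sqr_ge0.
- exact/measurable_EFinP/measurable_funX.
(* With this choice [a n ^- 2] is the square of 1 + [harmonic n], so [e n] is a polynomial in
   [harmonic n] with nonnegative coefficients: positivity, monotonicity and the limit 0 can be read
   off. *)
pose a (n : nat) : R := (1 + harmonic n)^-1.
pose e n : R := (a n ^- 2 - 1) / (2 * s ^+ 2).
have h0 n : 0 < harmonic n :> R by exact: harmonic_gt0.
have a0 n : 0 < a n by rewrite invr_gt0 addr_gt0.
have eE n : e n = (2 * harmonic n + harmonic n ^+ 2) / (2 * s ^+ 2).
  by rewrite /e /a exprVn invrK; congr (_ / _); ring.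
have e0 n : 0 < e n.
  by rewrite eE divr_gt0 ?mulr_gt0 ?exprn_gt0 // addr_gt0 ?mulr_gt0 ?exprn_gt0.
have hcvg : harmonic n @[n --> \oo] --> (0 : R) by exact: cvg_harmonic.
have ecvg : e n @[n --> \oo] --> 0.
  rewrite (_ : e = fun n => (2 * harmonic n + harmonic n * harmonic n) / (2 * s ^+ 2)); last first.
    by apply/funext => n; rewrite eE expr2.
  have <- : (2 * 0 + 0 * 0) / (2 * s ^+ 2) = 0 by ring.
  apply: cvgM; last exact: cvg_cst.
  by apply: cvgD; apply: cvgM => //; exact: cvg_cst.
pose f n x : R := (1 - expR (- (e n * x ^+ 2))) / e n * normal_pdf 0 s x.
have f0 n x : 0 <= f n x.
  rewrite mulr_ge0 ?normal_pdf_ge0 // divr_ge0 ?(ltW (e0 n)) // subr_ge0 -[leRHS]expR0.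
  by rewrite ler_expR oppr_le0 mulr_ge0 ?sqr_ge0 ?(ltW (e0 n)).
have mf n : measurable_fun setT (f n).
  apply: measurable_funM; last exact: measurable_normal_pdf.
  apply: measurable_funM => //; apply: measurable_funB => //.
  apply: measurableT_comp => //; apply: measurableT_comp => //.
  by apply: measurable_funM => //; exact: measurable_funX.
have intf n : (\int[lebesgue_measure]_x (f n x)%:E = ((1 - a n) / e n)%:E)%E.
  have fE x : f n x = (e n)^-1 * (normal_pdf 0 s x - a n * normal_pdf 0 (a n * s) x).
    by rewrite normal_pdf_scale // /f -/(e n); ring.
  under eq_integral do rewrite fE EFinM EFinB EFinM.
  have i1 := @integrable_normal_pdf R 0 s.
  have i2 : lebesgue_measure.-integrable [set: R]
      (fun x => ((a n)%:E * (normal_pdf 0 (a n * s) x)%:E)%E).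
    by apply: integrableZl => //; exact: integrable_normal_pdf.
  rewrite integralZl //; last exact: integrableB.
  rewrite integralB // integralZl //; last exact: integrable_normal_pdf.
  by rewrite !integral_normal_pdf mule1 -EFinB -EFinM mulrC.
have fcvg x : (f n x)%:E @[n --> \oo] --> ((x ^+ 2)%:E * (normal_pdf 0 s x)%:E)%E.
  apply: cvg_EFin; first exact: nearW.
  apply: cvgM; last exact: cvg_cst.
  by apply: expR_quotient_cvg => //; exact: sqr_ge0.
have icvg : (\int[lebesgue_measure]_x (f n x)%:E)%E @[n --> \oo] -->
    (\int[lebesgue_measure]_x ((x ^+ 2)%:E * (normal_pdf 0 s x)%:E))%E.
  under [X in _ --> X]eq_integral do rewrite -(cvg_lim _ (fcvg _)) //.
  apply: cvg_monotone_convergence => //.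
  - by move=> n; apply/measurable_EFinP; exact: mf.
  - by move=> n x _; rewrite lee_fin.
  - move=> x _ n m nm; rewrite lee_fin ler_wpM2r ?normal_pdf_ge0 //.
    apply: expR_quotient_nincr; first exact: e0.
    have hnm : harmonic m <= harmonic n :> R.
      by rewrite /harmonic lef_pV2 ?posrE // ler_nat ltnS.
    rewrite !eE ler_pM2r ?invr_gt0 ?mulr_gt0 ?exprn_gt0 //.
    by move: hnm (h0 m) (h0 n); move: (harmonic m) (harmonic n) => p q; nra.
have icvg' : ((1 - a n) / e n)%:E @[n --> \oo] --> (s ^+ 2)%:E.
  apply: cvg_EFin; first exact: nearW.
  have E n : (1 - a n) / e n = 2 * s ^+ 2 / ((1 + harmonic n) * (2 + harmonic n)).
    rewrite eE /a; move: (h0 n); move: (harmonic n) => p p0; field.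
    by apply/and4P; split; rewrite gt_eqF //; nra.
  rewrite (_ : _ \o _ = fun n => 2 * s ^+ 2 / ((1 + harmonic n) * (2 + harmonic n))); last exact/funext.
  have L : (2 * s ^+ 2 / ((1 + harmonic n) * (2 + harmonic n))) @[n --> \oo] -->
      2 * s ^+ 2 / ((1 + 0) * (2 + 0)).
    apply: cvgM; first exact: cvg_cst.
    apply: cvgV; first by rewrite !addr0 mul1r.
    by apply: cvgM; apply: cvgD => //; exact: cvg_cst.
  by rewrite (_ : 2 * s ^+ 2 / ((1 + 0) * (2 + 0)) = s ^+ 2) in L; last field.
have IE : (fun n => \int[lebesgue_measure]_x (f n x)%:E)%E = (fun n => ((1 - a n) / e n)%:E).
  exact/funext.
rewrite IE in icvg; exact: cvg_unique icvg icvg'.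
Qed.

Lemma lebesgue_integral_opp (R : realType) (f : R -> \bar R) :
  measurable_fun setT f -> (forall x, 0 <= f x)%E ->
  (\int[lebesgue_measure]_x f (- x)%R = \int[lebesgue_measure]_x f x)%E.
Proof.
move=> mf f0.
rewrite -[LHS](@ge0_integral_pushforward _ _ _ _ _ (-%R : measurableTypeR R -> measurableTypeR R) _ lebesgue_measure setT f) //.
by apply: eq_measure_integral => //= A mA _; exact: lebesgue_measureN.
Qed.

Lemma normal_integral_opp (R : realType) (s : R) (f : R -> \bar R) : s != 0 ->
  measurable_fun setT f -> (forall x, 0 <= f x)%E ->
  (\int[normal_prob 0 s]_x f (- x)%R = \int[normal_prob 0 s]_x f x)%E.
Proof.
move=> s0 mf f0; rewrite !integral_normal_prob //; last exact: measurableT_comp.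
rewrite -[RHS]lebesgue_integral_opp; last 2 first.
- by apply: emeasurable_funM => //; apply/measurable_EFinP; exact: measurable_normal_pdf.
- by move=> x; rewrite mule_ge0 // lee_fin normal_pdf_ge0.
apply: eq_integral => x _; congr (_ * (_)%:E)%E.
by rewrite !normal_pdfE // /normal_fun !subr0 sqrrN.
Qed.

(** Positive and negative parts have equal integrals by symmetry. They cancel only because they are
    finite, which the second moment provides through max(x, 0) <= 1 + x^2. *)
Lemma normal_mean (R : realType) (s : R) : 0 < s ->
  (\int[normal_prob 0 s]_x x%:E = 0)%E.
Proof.
move=> sp; have s0 : s != 0 by rewrite gt_eqF.
rewrite integralE.
have mp : measurable_fun setT (fun x : R => (Num.max x 0)%:E).
  by apply/measurable_EFinP; exact: measurable_maxr.
have E1 : (\int[normal_prob 0 s]_x (EFin : R -> \bar R)^\+%E x =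
    \int[normal_prob 0 s]_x (Num.max x 0)%:E)%E.
  by apply: eq_integral => x _; rewrite funeposE -EFin_max.
have -> : (\int[normal_prob 0 s]_x (EFin : R -> \bar R)^\-%E x =
    \int[normal_prob 0 s]_x (Num.max x 0)%:E)%E.
  rewrite -(normal_integral_opp s0 mp).
    by apply: eq_integral => x _; rewrite funenegE -EFinN -EFin_max.
  by move=> x; rewrite lee_fin le_max lexx orbT.
rewrite E1 subee // ge0_fin_numE; last first.
  by apply: integral_ge0 => x _; rewrite lee_fin le_max lexx orbT.
apply: (@le_lt_trans _ _ (\int[normal_prob 0 s]_x (1 + (x ^+ 2)%:E))%E).
  apply: ge0_le_integral => //.
  - by move=> x _; rewrite lee_fin le_max lexx orbT.
  - apply: emeasurable_funD => //; exact/measurable_EFinP/measurable_funX.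
  - move=> x _; rewrite -EFinD lee_fin ge_max addr_ge0 ?sqr_ge0 // andbT.
    by have := sqr_ge0 (x - 1); have := sqr_ge0 x; lra.
rewrite ge0_integralD //; last 2 first.
- by move=> x _; rewrite lee_fin sqr_ge0.
- exact/measurable_EFinP/measurable_funX.
by rewrite normal_second_moment // integral_cst //= mul1e probability_setT -EFinD ltry.
Qed.

(** * Square integrable variables and independence *)

Definition sq_integrable dp (T : measurableType dp) (R : realType)
    (mu : {measure set T -> \bar R}) (f : T -> R) : Prop :=
  measurable_fun setT f /\ (\int[mu]_x (f x ^+ 2)%:E < +oo)%E.

Lemma sq_integrable_mul dp (T : measurableType dp) (R : realType)
    (mu : {measure set T -> \bar R}) (f g : T -> R) :
  sq_integrable mu f -> sq_integrable mu g ->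
  mu.-integrable setT (fun x => (f x * g x)%:E).
Proof.
move=> [mf if2] [mg ig2].
have I (h : T -> R) : measurable_fun setT h -> (\int[mu]_x (h x ^+ 2)%:E < +oo)%E ->
    mu.-integrable setT (fun x => (h x ^+ 2)%:E).
  move=> mh ih; apply/integrableP; split.
    exact/measurable_EFinP/measurable_funX.
  by under eq_integral do rewrite /= ger0_norm ?sqr_ge0 //.
apply: (le_integrable measurableT _ _ (integrableD measurableT (I f mf if2) (I g mg ig2))).
  exact/measurable_EFinP/measurable_funM.
move=> x _ /=; rewrite lee_fin [leRHS]ger0_norm ?addr_ge0 ?sqr_ge0 // normrM.
rewrite -(real_normK (num_real (f x))) -(real_normK (num_real (g x))).
by have := sqr_ge0 (`|f x| - `|g x|); have := sqr_ge0 (`|f x| + `|g x|); nra.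
Qed.

(* Independence is only used on preimages; the joint law is then the product
   of the laws and Fubini applies. *)
Lemma integral_mul_independent dp (T : measurableType dp) (R : realType)
    (P : probability T R) (X Y : T -> R) :
  measurable_fun setT X -> measurable_fun setT Y ->
  P.-integrable setT (fun w => (X w * Y w)%:E) ->
  P.-integrable setT (fun w => (Y w)%:E) ->
  (forall A B, measurable A -> measurable B ->
    P (X @^-1` A `&` Y @^-1` B) = P (X @^-1` A) * P (Y @^-1` B))%E ->
  (\int[P]_w (Y w)%:E = 0)%E ->
  (\int[P]_w (X w * Y w)%:E = 0)%E.
Proof.
move=> mX mY iXY iY indep Y0.
pose X' : {RV P >-> R} := mfun_Sub (mem_set mX).
pose Y' : {RV P >-> R} := mfun_Sub (mem_set mY).
have mZ : measurable_fun setT (fun w => (X w, Y w)) by exact: measurable_fun_pair.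
pose Z' : {mfun T >-> (R * R)%type} := mfun_Sub (mem_set mZ).
pose f (z : R * R) : \bar R := (z.1 * z.2)%:E.
have mf : measurable_fun [set: (R * R)%type] f.
  by apply/measurable_EFinP/measurable_funM.
have law B : measurable B -> (distribution P X' \x distribution P Y')%E B = distribution P Z' B.
  apply: product_measure_unique => A C mA mC /=.
  by rewrite /distribution /pushforward /= -indep.
have iZ : (distribution P Z').-integrable setT f.
  exact: (integrable_pushforward (phi := Z') _ mf iXY measurableT).
have iL : (distribution P X' \x distribution P Y')%E.-integrable setT f.
  apply/integrableP; split => //.
  rewrite (eq_measure_integral (distribution P Z')); last by move=> A mA _; exact: law.
  by have /integrableP[] := iZ.
have -> : (\int[P]_w (X w * Y w)%:E = \int[distribution P Z']_z f z)%E.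
  by rewrite (integral_pushforward (phi := Z') _ mf iXY measurableT).
rewrite (eq_measure_integral (distribution P X' \x distribution P Y')%E); last first.
  by move=> A mA _; apply/esym; exact: law.
rewrite -(integral12_prod_meas1 iL) /fubini_F /f /=.
apply: integral0_eq => x _.
have iYd : (distribution P Y').-integrable setT (EFin : R -> \bar R).
  exact: (integrable_pushforward (phi := Y') _ _ iY measurableT).
under eq_integral do rewrite EFinM.
rewrite integralZl //.
have -> : (\int[distribution P Y']_y y%:E = \int[P]_w (Y w)%:E)%E.
  exact: (integral_pushforward (phi := Y') _ _ iY measurableT).
by rewrite Y0 mule0.
Qed.

(** * Gaussian vectors and the covariance of Brownian motion *)

Lemma adapted_random_vector dp (Omega : measurableType dp) (R : realType)
    (F : R -> set (set Omega)) d (D : set R) (Y : R -> Omega -> 'cV[R]_d) (t : R) :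
  filtration F -> adapted F D Y -> 0 <= t -> D t -> random_vector (Y t).
Proof.
move=> fF aY t0 Dt i _ B mB; rewrite setTI.
apply: (filtration_sub fF t0); apply: aY => //.
by apply: sub_sigma_algebra; exists i, B.
Qed.

Lemma random_vectorB dp (Omega : measurableType dp) (R : realType) d
    (X Y : Omega -> 'cV[R]_d) :
  random_vector X -> random_vector Y -> random_vector (fun w => X w - Y w).
Proof.
move=> mX mY i; under eq_fun do rewrite mxE [X in _ + X]mxE.
by apply: measurable_funB; [exact: mX | exact: mY].
Qed.

Lemma isotropic_gaussian_coord dp (Omega : measurableType dp) (R : realType)
    (P : probability Omega R) m (v : R) (Y : Omega -> 'cV[R]_m) i (A : set R) :
  isotropic_gaussian P v Y -> measurable A ->
  P ((fun w => Y w i 0) @^-1` A) = normal_prob 0 (Num.sqrt v) A.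
Proof.
move=> gY mA.
have := gY (fun j => if j == i then A else setT) _.
rewrite (bigD1 i) //= eqxx big1 ?mule1 => [|j /negbTE -> ]; last exact: probability_setT.
move=> <-; last by move=> j; case: ifP.
congr (P _); apply/seteqP; split => w /=; first by move=> Aw j; case: eqP => // ->.
by move/(_ i); rewrite eqxx.
Qed.

Lemma isotropic_gaussian_pair dp (Omega : measurableType dp) (R : realType)
    (P : probability Omega R) m (v : R) (Y : Omega -> 'cV[R]_m) i j (A B : set R) :
  isotropic_gaussian P v Y -> i != j -> measurable A -> measurable B ->
  P ((fun w => Y w i 0) @^-1` A `&` (fun w => Y w j 0) @^-1` B)
  = (P ((fun w => Y w i ord0) @^-1` A) * P ((fun w => Y w j ord0) @^-1` B))%E.
Proof.
move=> gY ij mA mB; rewrite !(isotropic_gaussian_coord _ gY) //.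
have := gY (fun k => if k == i then A else if k == j then B else setT) _.
rewrite (bigD1 i) //= eqxx (bigD1 j) /= 1?eq_sym // (negbTE ij) eqxx.
rewrite big1 ?mule1; last first.
  by move=> k /andP[/negbTE -> /negbTE ->]; exact: probability_setT.
move=> <-; last by move=> k; do 2 case: ifP => // _.
congr (P _); apply/seteqP; split => w /=.
  by move=> [Aw Bw] k; case: eqP => [->//|_]; case: eqP => [->|].
move=> H; split; first by have := H i; rewrite eqxx.
by have := H j; rewrite eqxx eq_sym (negbTE ij).
Qed.

Lemma isotropic_gaussian_sqr dp (Omega : measurableType dp) (R : realType)
    (P : probability Omega R) m (v : R) (Y : Omega -> 'cV[R]_m) i :
  0 < v -> random_vector Y -> isotropic_gaussian P v Y ->
  (\int[P]_w (Y w i 0 ^+ 2)%:E = v%:E)%E.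
Proof.
move=> v0 mY gY.
have m2 : measurable_fun [set: measurableTypeR R] (fun x : R => (x ^+ 2)%:E).
  exact/measurable_EFinP/measurable_funX.
transitivity (\int[normal_prob 0 (Num.sqrt v)]_x (x ^+ 2)%:E)%E.
  rewrite -[LHS](@ge0_integral_pushforward _ _ Omega (measurableTypeR R) R
    (fun w => Y w i 0) (mY i) P setT _ measurableT m2); last first.
    by move=> x _; rewrite lee_fin sqr_ge0.
  apply: eq_measure_integral; first exact: (mY i).
  by move=> ? A mA _; exact: (isotropic_gaussian_coord i gY mA).
by rewrite normal_second_moment ?sqrtr_gt0 // sqr_sqrtr // ltW.
Qed.

Lemma isotropic_gaussian_sq_integrable dp (Omega : measurableType dp) (R : realType)
    (P : probability Omega R) m (v : R) (Y : Omega -> 'cV[R]_m) i :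
  0 < v -> random_vector Y -> isotropic_gaussian P v Y ->
  sq_integrable P (fun w => Y w i 0).
Proof.
by move=> v0 mY gY; split; [exact: mY | rewrite (isotropic_gaussian_sqr i v0) // ltry].
Qed.

Lemma sq_integrable_cst dp (Omega : measurableType dp) (R : realType)
    (P : probability Omega R) (c : R) : sq_integrable P (fun=> c).
Proof.
split; first exact: measurable_cst.
by rewrite integral_cst //= probability_setT mule1 ltry.
Qed.

Lemma sq_integrable_integrable dp (Omega : measurableType dp) (R : realType)
    (P : probability Omega R) (f : Omega -> R) : sq_integrable P f ->
  P.-integrable setT (fun w => (f w)%:E).
Proof.
move=> /(sq_integrable_mul (sq_integrable_cst P 1)).
by under eq_fun do rewrite mul1r.
Qed.

Lemma isotropic_gaussian_mean dp (Omega : measurableType dp) (R : realType)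
    (P : probability Omega R) m (v : R) (Y : Omega -> 'cV[R]_m) i :
  0 < v -> random_vector Y -> isotropic_gaussian P v Y ->
  (\int[P]_w (Y w i 0)%:E = 0)%E.
Proof.
move=> v0 mY gY.
have iY := sq_integrable_integrable (isotropic_gaussian_sq_integrable i v0 mY gY).
have m1 : measurable_fun [set: measurableTypeR R] (EFin : R -> \bar R) by [].
transitivity (\int[normal_prob 0 (Num.sqrt v)]_x x%:E)%E.
  rewrite -[LHS](@integral_pushforward _ _ Omega (measurableTypeR R) R
    (fun w => Y w i 0) (mY i) P setT _ m1 iY measurableT).
  apply: eq_measure_integral; first exact: (mY i).
  by move=> ? A mA _; exact: (isotropic_gaussian_coord i gY mA).
by rewrite normal_mean ?sqrtr_gt0.
Qed.

Lemma ae_eq_integralT dp (T : measurableType dp) (R : realType)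
    (mu : {measure set T -> \bar R}) (f g : T -> R) :
  measurable_fun setT f -> measurable_fun setT g -> {ae mu, forall x, f x = g x} ->
  (\int[mu]_x (f x)%:E = \int[mu]_x (g x)%:E)%E.
Proof.
move=> mf mg fg; apply: ae_eq_integral => //; try exact/measurable_EFinP.
by apply: filterS fg => x -> _.
Qed.

Lemma bm_random_vector dp (Omega : measurableType dp) (R : realType)
    (P : probability Omega R) (F : R -> set (set Omega)) m (W : R -> Omega -> 'cV[R]_m) (t : R) :
  filtration F -> brownian_motion P F W -> 0 <= t -> random_vector (W t).
Proof. by move=> fF bW t0; apply: (adapted_random_vector fF (bm_adapted bW)). Qed.

(** The Gaussian law is postulated for increments only, and [W 0] vanishes only almost surely.
    Moments of [W t] are therefore computed on this increment. *)
Lemma bm_ae_incr dp (Omega : measurableType dp) (R : realType)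
    (P : probability Omega R) (F : R -> set (set Omega)) m (W : R -> Omega -> 'cV[R]_m) (t : R) :
  brownian_motion P F W -> {ae P, forall w, W t w = W t w - W 0 w}.
Proof. by move=> bW; apply: filterS (bm_start bW) => w ->; rewrite subr0. Qed.

Lemma bm_sqr dp (Omega : measurableType dp) (R : realType)
    (P : probability Omega R) (F : R -> set (set Omega)) m (W : R -> Omega -> 'cV[R]_m) (t : R) i :
  filtration F -> brownian_motion P F W -> 0 <= t ->
  (\int[P]_w (W t w i 0 ^+ 2)%:E = t%:E)%E.
Proof.
move=> fF bW t0; have mW u := @bm_random_vector _ _ _ _ _ _ _ u fF bW.
rewrite (ae_eq_integralT (g := fun w => ((W t w - W 0 w) i 0) ^+ 2)); last 3 first.
- by apply: measurable_funX; exact: mW.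
- by apply: measurable_funX; apply: random_vectorB; exact: mW.
- by apply: filterS (bm_ae_incr t bW) => w {1}->.
move: t0; rewrite le_eqVlt => /predU1P[<-|t0].
  by under eq_integral do rewrite subrr mxE expr0n; rewrite integral0.
rewrite (isotropic_gaussian_sqr i _ _ (bm_gaussian bW (lexx 0) t0)) ?subr0 //.
by apply: random_vectorB; apply: mW => //; exact: ltW.
Qed.

Lemma bm_sq_integrable dp (Omega : measurableType dp) (R : realType)
    (P : probability Omega R) (F : R -> set (set Omega)) m (W : R -> Omega -> 'cV[R]_m) (t : R) i :
  filtration F -> brownian_motion P F W -> 0 <= t ->
  sq_integrable P (fun w => W t w i 0).
Proof.
by move=> fF bW t0; split; [exact: (bm_random_vector fF bW t0) | rewrite (bm_sqr _ fF bW) // ltry].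
Qed.

(** At equal times, distinct coordinates are independent and centred. In general [W t] is [W s] plus
    a centred increment independent of [F s]. The cases s = 0 and s = t are treated apart because
    increments are Gaussian only over intervals of positive length. *)
Lemma bm_cov_le dp (Omega : measurableType dp) (R : realType)
    (P : probability Omega R) (F : R -> set (set Omega)) m (W : R -> Omega -> 'cV[R]_m) (s t : R) i j :
  filtration F -> brownian_motion P F W -> 0 <= s -> s <= t ->
  (\int[P]_w (W s w i 0 * W t w j 0)%:E = ((i == j)%:R * s)%:E)%E.
Proof.
move=> fF bW s0 st; have t0 := le_trans s0 st.
have mW u := @bm_random_vector _ _ _ _ _ _ _ u fF bW.
have iW u k := @bm_sq_integrable _ _ _ _ _ _ _ u k fF bW.
have diag : (\int[P]_w (W s w i 0 * W s w j 0)%:E = ((i == j)%:R * s)%:E)%E.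
  have [->|ij] := eqVneq i j.
    by rewrite mul1r -(bm_sqr j fF bW s0); apply: eq_integral => w _; rewrite expr2.
  rewrite mul0r.
  rewrite (ae_eq_integralT (g := fun w => (W s w - W 0 w) i 0 * (W s w - W 0 w) j 0)); last 3 first.
  - by apply: measurable_funM; exact: mW.
  - by apply: measurable_funM; apply: random_vectorB; exact: mW.
  - by apply: filterS (bm_ae_incr s bW) => w {1 2}->.
  move: s0; rewrite le_eqVlt => /predU1P[<-|sp].
    by under eq_integral do rewrite subrr mxE mul0r; rewrite integral0.
  have gY := bm_gaussian bW (lexx 0) sp.
  have mY : random_vector (fun w => W s w - W 0 w).
    by apply: random_vectorB; apply: mW => //; exact: ltW.
  have v0 : 0 < s - 0 by rewrite subr0.
  have iY k := isotropic_gaussian_sq_integrable k v0 mY gY.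
  apply: (integral_mul_independent (mY i) (mY j)).
  - exact: sq_integrable_mul.
  - exact: sq_integrable_integrable.
  - by move=> A B mA mB; exact: (isotropic_gaussian_pair gY ij mA mB).
  - exact: isotropic_gaussian_mean mY gY.
move: st; rewrite le_eqVlt => /predU1P[<-//|st].
have mY : random_vector (fun w => W t w - W s w) by apply: random_vectorB; exact: mW.
have gY := bm_gaussian bW s0 st.
have v0 : 0 < t - s by rewrite subr_gt0.
have iY k := isotropic_gaussian_sq_integrable k v0 mY gY.
transitivity (\int[P]_w ((W s w i 0 * W s w j 0)%:E + (W s w i 0 * (W t w - W s w) j 0)%:E))%E.
  by apply: eq_integral => w _; rewrite -EFinD !mxE; congr (_%:E); ring.
rewrite integralD //; last 2 first.
- by apply: sq_integrable_mul; exact: iW.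
- by apply: sq_integrable_mul; [exact: iW | exact: iY].
rewrite diag (integral_mul_independent (mW _ s0 i) (mY j)) ?adde0 //.
- by apply: sq_integrable_mul; [exact: iW | exact: iY].
- exact: sq_integrable_integrable.
- move=> A B mA mB; apply: (bm_independent bW s0 st).
    by apply: (bm_adapted bW s0); apply: sub_sigma_algebra; exists i, A.
  by apply: sub_sigma_algebra; exists j, B.
- exact: isotropic_gaussian_mean mY gY.
Qed.

Lemma bm_cov dp (Omega : measurableType dp) (R : realType)
    (P : probability Omega R) (F : R -> set (set Omega)) m (W : R -> Omega -> 'cV[R]_m) (s t : R) i j :
  filtration F -> brownian_motion P F W -> 0 <= s -> 0 <= t ->
  (\int[P]_w (W s w i 0 * W t w j 0)%:E = ((i == j)%:R * Num.min s t)%:E)%E.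
Proof.
move=> fF bW s0 t0; have [st|/ltW ts] := leP s t; first exact: (bm_cov_le _ _ fF bW).
under eq_integral do rewrite mulrC.
by rewrite (bm_cov_le _ _ fF bW) // eq_sym.
Qed.

(** * Integrals of deterministic functions against Brownian motion *)

Lemma integral_sqr_sum dp (T : measurableType dp) (R : realType)
    (mu : {measure set T -> \bar R}) (J : finType) (G : J -> T -> R) :
  (forall j, sq_integrable mu (G j)) ->
  (\int[mu]_x ((\sum_j G j x) ^+ 2)%:E =
   \sum_j \sum_k \int[mu]_x (G j x * G k x)%:E)%E.
Proof.
move=> sG.
transitivity (\int[mu]_x (\sum_j \sum_k (G j x * G k x)%:E))%E.
  apply: eq_integral => x _; rewrite expr2 mulr_suml -sumEFin; apply: eq_bigr => j _.
  by rewrite mulr_sumr -sumEFin.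
rewrite integral_sum // => [|j].
  by apply: eq_bigr => j _; rewrite integral_sum // => k; exact: sq_integrable_mul.
by apply: integrable_sum => // k _; exact: sq_integrable_mul.
Qed.

Lemma lebesgue_measure_itv_oc (R : realType) (a b : R) : a <= b ->
  lebesgue_measure `]a, b]%classic = (b - a)%:E.
Proof.
move=> ab; apply: (etrans (lebesgue_measure_itv `]a, b])); rewrite /= lte_fin.
case: ltP => // ba; have -> : a = b by apply/le_anti; rewrite ab.
by rewrite subrr.
Qed.

(** The kernel is that of [bm_cov]; the isometry of [step_isometry] rests on this coincidence. *)
Lemma lebesgue_indic_mul (R : realType) (s t : R) : 0 <= s -> 0 <= t ->
  (\int[lebesgue_measure]_u (\1_(`]0, s]%classic) u * \1_(`]0, t]%classic) u)%:E
   = (Num.min s t)%:E)%E.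
Proof.
move=> s0 t0.
have E u : \1_(`]0%R, s]%classic) u * \1_(`]0%R, t]%classic) u =
    \1_(`]0%R, Num.min s t]%classic) u :> R.
  rewrite !indicE -natrM mulnb; congr (_%:R); congr nat_of_bool.
  apply/andP/idP => [[]|]; rewrite !inE /= !in_itv /= le_min.
    by move=> /andP[-> ->] /andP[_ ->].
  by move=> /and3P[-> -> ->].
under eq_integral do rewrite E.
rewrite integral_indic // setIT.
by rewrite -[RHS](congr1 EFin (subr0 _)); apply: lebesgue_measure_itv_oc; rewrite le_min s0.
Qed.

Lemma sq_integrable_indic (R : realType) (c t : R) : 0 <= t ->
  sq_integrable lebesgue_measure (fun u => c * \1_(`]0, t]%classic) u).
Proof.
move=> t0; split; first by apply: measurable_funM => //; exact: measurable_indic.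
have E u : (c * \1_(`]0%R, t]%classic) u) ^+ 2 =
    c ^+ 2 * (\1_(`]0%R, t]%classic) u * \1_(`]0%R, t]%classic) u) :> R by ring.
under eq_integral do rewrite E EFinM.
rewrite ge0_integralZl_EFin ?sqr_ge0 //.
- by rewrite lebesgue_indic_mul // -EFinM ltry.
- by apply/measurable_EFinP/measurable_funM; exact: measurable_indic.
Qed.

Lemma indic_itv_sub (R : realType) (a b u : R) : 0 <= a -> a <= b ->
  \1_(`]a, b]%classic) u = \1_(`]0, b]%classic) u - \1_(`]0, a]%classic) u :> R.
Proof.
move=> a0 ab; rewrite !indicE !mem_setE !in_itv /=.
case: (ltP a u) => au; case: (ltP 0 u) => u0; case: (leP u b) => ub;
  case: (leP u a) => ua; rewrite /= ?subrr ?subr0 //; exfalso; lra.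
Qed.

Lemma integral_sqr_indic_sum (R : realType) (J : finType) (g t : J -> R) :
  (forall j, 0 <= t j) ->
  (\int[lebesgue_measure]_u ((\sum_j g j * \1_(`]0%R, t j]%classic) u) ^+ 2)%:E
   = (\sum_j \sum_k g j * g k * Num.min (t j) (t k))%R%:E)%E.
Proof.
move=> t0; rewrite integral_sqr_sum; last by move=> j; exact: sq_integrable_indic.
rewrite -sumEFin; apply: eq_bigr => j _; rewrite -sumEFin; apply: eq_bigr => k _.
under eq_integral do rewrite mulrACA EFinM.
rewrite integralZl //.
  by rewrite lebesgue_indic_mul.
have := sq_integrable_mul (sq_integrable_indic 1 (t0 j)) (sq_integrable_indic 1 (t0 k)).
by under eq_fun do rewrite !mul1r.
Qed.

Lemma integral_sqr_bm_sum dp (Omega : measurableType dp) (R : realType)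
    (P : probability Omega R) (F : R -> set (set Omega)) m (W : R -> Omega -> 'cV[R]_m)
    (J : finType) (g : J -> 'I_m -> R) (t : J -> R) :
  filtration F -> brownian_motion P F W -> (forall j, 0 <= t j) ->
  (\int[P]_w ((\sum_j \sum_l g j l * W (t j) w l ord0) ^+ 2)%:E
   = (\sum_l \sum_j \sum_k g j l * g k l * Num.min (t j) (t k))%R%:E)%E.
Proof.
move=> fF bW t0.
have sG (p : J * 'I_m) : sq_integrable P (fun w => g p.1 p.2 * W (t p.1) w p.2 0).
  have [mW iW] := bm_sq_integrable p.2 fF bW (t0 p.1).
  split; first by apply: measurable_funM.
  under eq_integral do rewrite exprMn EFinM.
  rewrite ge0_integralZl_EFin ?sqr_ge0 //.
  - by rewrite (bm_sqr _ fF bW) // -EFinM ltry.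
  - by move=> u _; rewrite lee_fin sqr_ge0.
  - exact/measurable_EFinP/measurable_funX.
transitivity (\int[P]_w ((\sum_(p : J * 'I_m) g p.1 p.2 * W (t p.1) w p.2 ord0) ^+ 2)%:E)%E.
  by apply: eq_integral => w _; rewrite pair_big.
rewrite integral_sqr_sum //.
transitivity (\sum_(p : J * 'I_m) \sum_(q : J * 'I_m)
   (g p.1 p.2 * g q.1 q.2 * ((p.2 == q.2)%:R * Num.min (t p.1) (t q.1)))%:E)%E.
  apply: eq_bigr => p _; apply: eq_bigr => q _.
  under eq_integral do rewrite mulrACA EFinM.
  rewrite integralZl //; first by rewrite (bm_cov _ _ fF bW) // -EFinM.
  by apply: sq_integrable_mul; exact: (bm_sq_integrable _ fF bW).
under eq_bigr do rewrite sumEFin.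
rewrite sumEFin; congr (_%:E).
have PB (h : J * 'I_m -> R) : \sum_p h p = \sum_j \sum_l h (j, l).
  by rewrite pair_bigA; apply: eq_bigr => -[].
rewrite PB exchange_big; apply: eq_bigr => l _; apply: eq_bigr => j _.
rewrite PB; apply: eq_bigr => k _ /=.
rewrite (bigD1 l) //= eqxx mul1r big1 ?addr0 // => i il.
by rewrite eq_sym (negbTE il) mul0r mulr0.
Qed.

(** Each step is split into its two endpoints with opposite signs: an increment of [W] is a
    difference of two values, and the indicator of []a, b]] a difference of indicators starting at
    0. Both sides then become the quadratic form of the same coefficients with kernel [Num.min]. *)
Lemma step_isometry dp (Omega : measurableType dp) (R : realType)
    (P : probability Omega R) (F : R -> set (set Omega)) d m (W : R -> Omega -> 'cV[R]_m)
    (s : step_code R d m) (x : 'cV[R]_d) :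
  filtration F -> brownian_motion P F W ->
  (forall p, p \in s -> 0 <= p.1.1 /\ p.1.1 <= p.1.2) ->
  (\int[P]_w (((x^T *m step_integral W s w) ord0 ord0) ^+ 2)%:E =
   \int[lebesgue_measure]_u (\sum_l ((x^T *m step_fun s u) ord0 l) ^+ 2)%R%:E)%E.
Proof.
move=> fF bW sP.
pose p (k : 'I_(size s)) := tnth (in_tuple s) k.
have pP k : 0 <= (p k).1.1 /\ (p k).1.1 <= (p k).1.2 by apply: sP; exact: mem_tnth.
(* The boolean selects the endpoint of a step: [true] is the right one with sign +1, [false] the
   left one with sign -1. *)
pose J : finType := ('I_(size s) * bool)%type.
pose t (j : J) := if j.2 then (p j.1).1.2 else (p j.1).1.1.
pose g (j : J) l := (if j.2 then 1 else -1) * (x^T *m (p j.1).2) 0 l.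
have t0 j : 0 <= t j.
  by rewrite /t; have [a0 ab] := pP j.1; case: j.2 => //; apply: le_trans ab.
have JE (h : J -> R) : \sum_j h j = \sum_k (h (k, true) + h (k, false)).
  transitivity (\sum_k \sum_b h (k, b)); first by rewrite pair_bigA; apply: eq_bigr => -[].
  by apply: eq_bigr => k _; rewrite big_bool.
have IE w : (x^T *m step_integral W s w) 0 0 = \sum_j \sum_l g j l * W (t j) w l 0.
  rewrite JE /step_integral big_tnth mulmx_sumr summxE; apply: eq_bigr => k _.
  rewrite -/(p k) mulmxA mxE -big_split /=; apply: eq_bigr => l _.
  by rewrite /g /t /= !mxE; ring.
have FE u l : (x^T *m step_fun s u) 0 l = \sum_j g j l * \1_(`]0%R, t j]%classic) u.
  rewrite JE /step_fun big_tnth mulmx_sumr summxE; apply: eq_bigr => k _.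
  rewrite -/(p k) -scalemxAr mxE /g /t /=; have [a0 ab] := pP k.
  by rewrite (indic_itv_sub _ a0 ab); ring.
under eq_integral do rewrite IE.
rewrite (integral_sqr_bm_sum _ fF bW) //.
under [RHS]eq_integral do under eq_bigr do rewrite FE.
under [RHS]eq_integral do rewrite -sumEFin.
rewrite ge0_integral_sum //.
- by rewrite -sumEFin; apply: eq_bigr => l _; rewrite integral_sqr_indic_sum.
- move=> l; apply/measurable_EFinP/measurable_funX.
  apply: measurable_sum => j; apply: measurable_funM => //; exact: measurable_indic.
- by move=> l u _; rewrite lee_fin sqr_ge0.
Qed.

(** * From step functions to increments of the stochastic integral *)

Lemma sqr_dot_unit_le (R : realDomainType) (I : finType) (x y : I -> R) :
  \sum_i x i ^+ 2 = 1 -> (\sum_i x i * y i) ^+ 2 <= \sum_i y i ^+ 2.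
Proof.
move=> x1; set c := \sum_i x i * y i.
have : 0 <= \sum_i (y i - c * x i) ^+ 2 by apply: sumr_ge0 => i _; exact: sqr_ge0.
have -> : \sum_i (y i - c * x i) ^+ 2 = \sum_i y i ^+ 2 - c ^+ 2.
  transitivity (\sum_i (y i ^+ 2 - (2 * c) * (x i * y i) + c ^+ 2 * x i ^+ 2)).
    by apply: eq_bigr => i _; ring.
  by rewrite big_split sumrB /= -!mulr_sumr x1 -/c; ring.
by rewrite subr_ge0.
Qed.

Lemma frobenius_sqE (R : realType) d m (A : 'M[R]_(d, m)) :
  frobenius_sq A = \sum_i \sum_l A i l ^+ 2.
Proof.
rewrite /frobenius_sq /mxtrace; apply: eq_bigr => i _; rewrite mxE.
by apply: eq_bigr => l _; rewrite mxE expr2.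
Qed.

Lemma frobenius_sq_ge0 (R : realType) d m (A : 'M[R]_(d, m)) : 0 <= frobenius_sq A.
Proof.
by rewrite frobenius_sqE; apply: sumr_ge0 => i _; apply: sumr_ge0 => l _; exact: sqr_ge0.
Qed.

Lemma trmul_colE (R : pzRingType) d m (x : 'cV[R]_d) (A : 'M[R]_(d, m)) l :
  (x^T *m A) 0 l = \sum_i x i 0 * A i l.
Proof. by rewrite mxE; apply: eq_bigr => i _; rewrite mxE. Qed.

(** For [A = sigma t] this is the instantaneous variance of the scalar process x^T X, that is x^T
    Sigma(t) x. *)
Definition rownorm_sq (R : realType) d m (x : 'cV[R]_d) (A : 'M[R]_(d, m)) : R :=
  \sum_l ((x^T *m A) ord0 l) ^+ 2.

Lemma rownorm_sq_ge0 (R : realType) d m (x : 'cV[R]_d) (A : 'M[R]_(d, m)) :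
  0 <= rownorm_sq x A.
Proof. by apply: sumr_ge0 => l _; exact: sqr_ge0. Qed.

Lemma rownorm_sq_le (R : realType) d m (x : 'cV[R]_d) (A : 'M[R]_(d, m)) :
  \sum_i x i 0 ^+ 2 = 1 -> rownorm_sq x A <= frobenius_sq A.
Proof.
move=> x1; rewrite frobenius_sqE exchange_big; apply: ler_sum => l _.
by rewrite trmul_colE; exact: sqr_dot_unit_le.
Qed.

Lemma mulmxB_entry (R : pzRingType) m n p (x : 'M[R]_(m, n)) (A B : 'M[R]_(n, p)) i j :
  (x *m (A - B)) i j = (x *m A) i j - (x *m B) i j.
Proof. by rewrite mulmxBr mxE [X in _ + X]mxE. Qed.

Lemma rownorm_sqD (R : realType) d m (x : 'cV[R]_d) (A B : 'M[R]_(d, m)) :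
  rownorm_sq x (A + B) <= 2 * rownorm_sq x A + 2 * rownorm_sq x B.
Proof.
rewrite /rownorm_sq !mulr_sumr -big_split; apply: ler_sum => l _ /=.
rewrite mulmxDr mxE; set a := (_ *m _) _ _; set b := (_ *m _) _ _.
by have := sqr_ge0 (a - b); lra.
Qed.

Lemma rownorm_sqN (R : realType) d m (x : 'cV[R]_d) (A : 'M[R]_(d, m)) :
  rownorm_sq x (- A) = rownorm_sq x A.
Proof. by apply: eq_bigr => l _; rewrite mulmxN mxE sqrrN. Qed.

Lemma rownorm_sq_outer (R : realType) d m (x : 'cV[R]_d) (A : 'M[R]_(d, m)) :
  rownorm_sq x A = (x^T *m (A *m A^T) *m x) 0 0.
Proof.
rewrite mulmxA -mulmxA [RHS]mxE; apply: eq_bigr => l _; rewrite expr2; congr (_ * _).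
by rewrite -[in RHS](trmxK x) -trmx_mul [in RHS]mxE.
Qed.

Lemma step_fun_eq0 (R : realType) d m (s : step_code R d m) (a b u : R) :
  (forall p, p \in s -> a <= p.1.1 /\ p.1.2 <= b) -> ~~ (a < u <= b) ->
  step_fun s u = 0.
Proof.
move=> sP uab; rewrite /step_fun big_seq big1 // => p /sP[pa pb].
rewrite indicE mem_setE in_itv /= (_ : _ && _ = false) ?scale0r //.
by apply: contraNF uab => /andP[h1 h2]; rewrite (le_lt_trans pa) // (le_trans h2).
Qed.

Lemma measurable_step_fun (R : realType) d m (s : step_code R d m) D i l :
  measurable D -> measurable_fun D (fun u => step_fun s u i l).
Proof.
move=> mD; rewrite (_ : (fun _ => _) =
    fun u => \sum_(p <- s) \1_(`]p.1.1, p.1.2]%classic) u * p.2 i l).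
  by apply: measurable_funTS; apply: measurable_sum => p; apply: measurable_funM.
by apply/funext => u; rewrite /step_fun summxE; apply: eq_bigr => p _; rewrite mxE.
Qed.

Lemma measurable_frobenius_sq dp (T : measurableType dp) (R : realType) d m D
    (f : T -> 'M[R]_(d, m)) : (forall i l, measurable_fun D (fun u => f u i l)) ->
  measurable_fun D (fun u => frobenius_sq (f u)).
Proof.
move=> mf; under eq_fun do rewrite frobenius_sqE.
by apply: measurable_sum => i; apply: measurable_sum => l; apply: measurable_funX.
Qed.

Lemma measurable_rownorm_sq dp (T : measurableType dp) (R : realType) d m D
    (x : 'cV[R]_d) (f : T -> 'M[R]_(d, m)) :
  (forall i l, measurable_fun D (fun u => f u i l)) ->
  measurable_fun D (fun u => rownorm_sq x (f u)).
Proof.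
move=> mf; apply: measurable_sum => l; apply: measurable_funX.
under eq_fun do rewrite trmul_colE.
by apply: measurable_sum => i; apply: measurable_funM.
Qed.

(** Subtraction of codes becomes concatenation with [step_neg], so that the isometry applies to a
    difference as it stands. *)
Definition step_neg (R : realType) d m (s : step_code R d m) : step_code R d m :=
  [seq (p.1, - p.2) | p <- s].

Lemma step_fun_sub (R : realType) d m (s1 s2 : step_code R d m) u :
  step_fun (s2 ++ step_neg s1) u = step_fun s2 u - step_fun s1 u.
Proof.
rewrite /step_fun big_cat big_map /= -sumrN; congr (_ + _).
by apply: eq_bigr => p _; rewrite scalerN.
Qed.

Lemma step_integral_sub (Omega : Type) (R : realType) d m
    (W : R -> Omega -> 'cV[R]_m) (s1 s2 : step_code R d m) w :
  step_integral W (s2 ++ step_neg s1) w = step_integral W s2 w - step_integral W s1 w.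
Proof.
rewrite /step_integral big_cat big_map /= -sumrN; congr (_ + _).
by apply: eq_bigr => p _; rewrite mulNmx.
Qed.

Lemma random_vector_step_integral dp (Omega : measurableType dp) (R : realType)
    (P : probability Omega R) (F : R -> set (set Omega)) d m (W : R -> Omega -> 'cV[R]_m)
    (s : step_code R d m) : filtration F -> brownian_motion P F W ->
  (forall p, p \in s -> 0 <= p.1.1 /\ p.1.1 <= p.1.2) ->
  random_vector (step_integral W s).
Proof.
move=> fF bW sP i.
rewrite (_ : (fun w => _) = fun w => \sum_(k < size s) \sum_l (tnth (in_tuple s) k).2 i l *
   (W (tnth (in_tuple s) k).1.2 w l 0 - W (tnth (in_tuple s) k).1.1 w l 0)); last first.
  apply/funext => w; rewrite /step_integral big_tnth summxE; apply: eq_bigr => k _.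
  by rewrite mxE; apply: eq_bigr => l _; rewrite !mxE.
apply: measurable_sum => k; apply: measurable_sum => l; apply: measurable_funM => //.
have [a0 ab] := sP _ (mem_tnth k (in_tuple s)).
apply: measurable_funB; apply: (bm_random_vector fF bW) => //.
exact: le_trans ab.
Qed.

Lemma measurable_dot dp (Omega : measurableType dp) (R : realType) d (x : 'cV[R]_d)
    (Y : Omega -> 'cV[R]_d) : random_vector Y ->
  measurable_fun setT (fun w => (x^T *m Y w) 0 0).
Proof.
move=> mY; under eq_fun do rewrite trmul_colE.
by apply: measurable_sum => i; apply: measurable_funM.
Qed.

Lemma measurable_enorm dp (T : measurableType dp) (R : realType) d D
    (Y : T -> 'cV[R]_d) : (forall i, measurable_fun D (fun w => Y w i 0)) ->
  measurable_fun D (fun w => enorm (Y w)).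
Proof.
move=> mY; have sq : measurable_fun setT (Num.sqrt : R -> R).
  by apply: continuous_measurable_fun; exact: sqrt_continuous.
by apply: (measurableT_comp sq); apply: measurable_sum => i; apply: measurable_funX.
Qed.

Lemma sqr_dot_le_enorm (R : realType) d (x y : 'cV[R]_d) :
  \sum_i x i 0 ^+ 2 = 1 -> ((x^T *m y) ord0 ord0) ^+ 2 <= enorm y ^+ 2.
Proof.
by move=> x1; rewrite (trmul_colE x y 0) sqr_enorm; exact: sqr_dot_unit_le.
Qed.

Lemma ge0_integral_lin3 dp (T : measurableType dp) (R : realType)
    (mu : {measure set T -> \bar R}) (c1 c2 c3 : R) (f1 f2 f3 : T -> \bar R) :
  0 <= c1 -> 0 <= c2 -> 0 <= c3 ->
  measurable_fun setT f1 -> measurable_fun setT f2 -> measurable_fun setT f3 ->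
  (forall x, 0 <= f1 x)%E -> (forall x, 0 <= f2 x)%E -> (forall x, 0 <= f3 x)%E ->
  (\int[mu]_x (c1%:E * f1 x + c2%:E * f2 x + c3%:E * f3 x) =
   c1%:E * \int[mu]_x f1 x + c2%:E * \int[mu]_x f2 x + c3%:E * \int[mu]_x f3 x)%E.
Proof.
move=> c10 c20 c30 mf1 mf2 mf3 f10 f20 f30.
have m (c : R) f : measurable_fun setT f -> measurable_fun setT (fun x : T => c%:E * f x)%E.
  by move=> mf; apply: emeasurable_funM.
have p (c : R) f : 0 <= c -> (forall x : T, 0 <= f x)%E -> forall x, setT x -> (0 <= c%:E * f x)%E.
  by move=> c0 f0 x _; rewrite mule_ge0.
rewrite ge0_integralD //; [|by move=> x _; rewrite adde_ge0 ?mule_ge0|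
  by apply: emeasurable_funD; exact: m|exact: p|exact: m].
rewrite ge0_integralD //; [|exact: p|exact: m|exact: p|exact: m].
by rewrite !ge0_integralZl_EFin.
Qed.

Lemma cvgeD_fin (R : realType) (u v : nat -> \bar R) (a b : R) :
  u n @[n --> \oo] --> a%:E -> v n @[n --> \oo] --> b%:E ->
  (u n + v n)%E @[n --> \oo] --> (a + b)%:E.
Proof. by move=> ua vb; rewrite EFinD; apply: cvgeD. Qed.

Lemma cvgeZ_fin (R : realType) (c : R) (u : nat -> \bar R) (a : R) :
  u n @[n --> \oo] --> a%:E -> (c%:E * u n)%E @[n --> \oo] --> (c * a)%:E.
Proof. by move=> ua; rewrite EFinM; apply: cvgeZl. Qed.

(** The increment is compared with the integral of the code [s2 - s1]. On []0, t1]] both codes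
    approximate [sigma], so their difference is negligible; on []t1, t2]] only [s2] is left, and
    [rownorm_sq] of it is at most 2 B up to an error; elsewhere both vanish. A second factor 2 comes
    from replacing the increment by its step approximation, whence the 4. *)
Lemma stochastic_integral_incr dp (Omega : measurableType dp) (R : realType)
    (P : probability Omega R) (F : R -> set (set Omega)) d m (W : R -> Omega -> 'cV[R]_m)
    (sigma : R -> 'M[R]_(d, m)) (t1 t2 B : R) (Z1 Z2 : Omega -> 'cV[R]_d) (x : 'cV[R]_d) :
  filtration F -> brownian_motion P F W ->
  (forall i l, measurable_fun `[0 : R, 1 : R]%classic (fun u => sigma u i l)) ->
  0 <= t1 -> t1 <= t2 -> t2 <= 1 -> \sum_i x i 0 ^+ 2 = 1 ->
  (forall u, t1 <= u <= t2 -> rownorm_sq x (sigma u) <= B) ->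
  is_stochastic_integral P W sigma t1 Z1 -> is_stochastic_integral P W sigma t2 Z2 ->
  (\int[P]_w (((x^T *m (Z2 w - Z1 w)) ord0 ord0) ^+ 2)%:E <= (4 * (B * (t2 - t1)))%:E)%E.
Proof.
move=> fF bW ms t10 t12 t21 x1 sB [mZ1 [s1 [s1P s1f s1Z]]] [mZ2 [s2 [s2P s2f s2Z]]].
have t20 := le_trans t10 t12.
have B0 : 0 <= B by apply: le_trans (sB t1 _); rewrite ?rownorm_sq_ge0 ?lexx.
pose e1 k := (\int[P]_w (enorm (Z1 w - step_integral W (s1 k) w) ^+ 2)%:E)%E.
pose e2 k := (\int[P]_w (enorm (Z2 w - step_integral W (s2 k) w) ^+ 2)%:E)%E.
pose f1 k := (\int[lebesgue_measure]_(u in `[0%R, t1]%classic)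
           (frobenius_sq (sigma u - step_fun (s1 k) u))%:E)%E.
pose f2 k := (\int[lebesgue_measure]_(u in `[0%R, t2]%classic)
           (frobenius_sq (sigma u - step_fun (s2 k) u))%:E)%E.
have s1Q k p : p \in s1 k -> 0 <= p.1.1 /\ p.1.1 <= p.1.2 by move=> /s1P[].
have s2Q k p : p \in s2 k -> 0 <= p.1.1 /\ p.1.1 <= p.1.2 by move=> /s2P[].
pose s k := s2 k ++ step_neg (s1 k).
have sQ k p : p \in s k -> 0 <= p.1.1 /\ p.1.1 <= p.1.2.
  by rewrite mem_cat => /orP[/s2Q//|/mapP[q /s1Q + ->]].
have mI1 k : random_vector (step_integral W (s1 k)).
  exact: (random_vector_step_integral fF bW (@s1Q k)).
have mI2 k : random_vector (step_integral W (s2 k)).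
  exact: (random_vector_step_integral fF bW (@s2Q k)).
have mI k : random_vector (step_integral W (s k)).
  exact: (random_vector_step_integral fF bW (@sQ k)).
have mf (t : R) (c : step_code R d m) : 0 <= t -> t <= 1 ->
    measurable_fun `[0, t]%classic (fun u => frobenius_sq (sigma u - step_fun c u)).
  move=> t0 tl; apply: measurable_frobenius_sq => i l.
  rewrite (_ : (fun _ => _) = fun u => sigma u i l - step_fun c u i l); last first.
    by apply/funext => u; rewrite mxE [X in _ + X]mxE.
  apply: measurable_funB; last exact: measurable_step_fun.
  apply: measurable_funS (ms i l) => // u /=; rewrite !in_itv /= => /andP[-> ut].
  exact: le_trans tl.
have D k : (\int[lebesgue_measure]_u (rownorm_sq x (step_fun (s k) u))%:E
    <= 2%:E * f2 k + 2%:E * f1 k + 2%:E * (B * (t2 - t1))%:E)%E.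
  (* The three terms of the bound are extended by 0 to the whole line, so that a single pointwise
     comparison covers all the regions. *)
  pose g1 u : \bar R := (((fun u => (frobenius_sq (sigma u - step_fun (s1 k) u))%:E)
                   \_ `[0%R, t1]%classic) u)%E.
  pose g2 u : \bar R := (((fun u => (frobenius_sq (sigma u - step_fun (s2 k) u))%:E)
                   \_ `[0%R, t2]%classic) u)%E.
  pose g3 u : \bar R := (B * \1_(`]t1, t2]%classic) u)%:E.
  have g10 u : (0 <= g1 u)%E by rewrite /g1 patchE; case: ifP; rewrite ?lee_fin ?frobenius_sq_ge0.
  have g20 u : (0 <= g2 u)%E by rewrite /g2 patchE; case: ifP; rewrite ?lee_fin ?frobenius_sq_ge0.
  have g30 u : (0 <= g3 u)%E by rewrite lee_fin mulr_ge0.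
  have mg1 : measurable_fun setT g1.
    by apply/(measurable_restrictT _ _).1 => //; apply/measurable_EFinP; apply: mf => //; exact: le_trans t21.
  have mg2 : measurable_fun setT g2.
    by apply/(measurable_restrictT _ _).1 => //; apply/measurable_EFinP; apply: mf.
  have mg3 : measurable_fun setT g3.
    by apply/measurable_EFinP/measurable_funM => //; exact: measurable_indic.
  apply: (@le_trans _ _ (\int[lebesgue_measure]_u (2%:E * g2 u + 2%:E * g1 u + 2%:E * g3 u))%E).
    apply: ge0_le_integral => //.
    - by move=> u _; rewrite lee_fin rownorm_sq_ge0.
    - apply/measurable_EFinP; apply: measurable_rownorm_sq => i l; exact: measurable_step_fun.
    - by apply: emeasurable_funD; [apply: emeasurable_funD|]; apply: emeasurable_funM.
    move=> u _; rewrite /s step_fun_sub.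
    (* The point 0 belongs to the domain of both error integrals but to no step interval, these
       being open on the left and contained in the half-line from 0. *)
    have [u0|u0] := leP u 0.
      rewrite !(@step_fun_eq0 _ _ _ _ 0 1); first last.
      + by rewrite ltNge u0.
      + by move=> p /s2P[a0 _ bt]; split => //; exact: le_trans t21.
      + by rewrite ltNge u0.
      + by move=> p /s1P[a0 _ bt]; split => //; rewrite (le_trans bt) // (le_trans t12).
      rewrite subrr /rownorm_sq big1; first by rewrite !adde_ge0 ?mule_ge0.
      by move=> l _; rewrite mulmx0 mxE expr0n.
    have [ut1|t1u] := leP u t1.
      rewrite /g1 /g2 !patchE !mem_setE !in_itv /= (ltW u0) ut1 (le_trans ut1 t12) /=.
      apply: (@le_trans _ _ (2%:E * (frobenius_sq (sigma u - step_fun (s2 k) u))%:E +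
        2%:E * (frobenius_sq (sigma u - step_fun (s1 k) u))%:E)%E); last first.
        by rewrite leeDl // mule_ge0.
      rewrite -!EFinM -EFinD lee_fin.
      have -> : step_fun (s2 k) u - step_fun (s1 k) u =
        - (sigma u - step_fun (s2 k) u) + (sigma u - step_fun (s1 k) u).
        by rewrite opprB addrA subrK.
      apply: (le_trans (rownorm_sqD _ _ _)); rewrite rownorm_sqN.
      by apply: lerD; rewrite ler_pM2l //; exact: rownorm_sq_le.
    rewrite (@step_fun_eq0 _ _ _ (s1 k) 0 t1); first last.
    + by rewrite [u <= t1]leNgt t1u andbF.
    + by move=> p /s1P[].
    rewrite subr0; have [ut2|t2u] := leP u t2; last first.
      rewrite (@step_fun_eq0 _ _ _ (s2 k) 0 t2); first last.
      + by rewrite [u <= t2]leNgt t2u andbF.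
      + by move=> p /s2P[].
      rewrite /rownorm_sq big1; first by rewrite !adde_ge0 ?mule_ge0.
      by move=> l _; rewrite mulmx0 mxE expr0n.
    apply: (@le_trans _ _ (2%:E * g2 u + 2%:E * g3 u)%E); last first.
      by rewrite leeD2r // leeDl // mule_ge0.
    rewrite /g2 patchE mem_setE in_itv /= (ltW u0) ut2 /=.
    rewrite /g3 indicE mem_setE in_itv /= t1u ut2 mulr1 -!EFinM -EFinD lee_fin.
    have -> : step_fun (s2 k) u = - (sigma u - step_fun (s2 k) u) + sigma u.
      by rewrite opprB subrK.
    apply: (le_trans (rownorm_sqD _ _ _)); rewrite rownorm_sqN opprD opprK addrCA subrr addr0.
    by apply: lerD; rewrite ler_pM2l //; [exact: rownorm_sq_le | apply: sB; rewrite (ltW t1u)].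
  rewrite ge0_integral_lin3 //.
  rewrite /g1 /g2 -!integral_mkcond -/(f1 k) -/(f2 k).
  rewrite leeD2l // /g3.
  under eq_integral do rewrite EFinM.
  rewrite ge0_integralZl_EFin //; last by apply/measurable_EFinP; exact: measurable_indic.
  rewrite integral_indic // setIT.
  rewrite [X in (B%:E * X)%E](_ : _ = (t2 - t1)%:E) -?EFinM //.
  exact: lebesgue_measure_itv_oc.
have S k : (\int[P]_w (((x^T *m (Z2 w - Z1 w)) ord0 ord0) ^+ 2)%:E <=
   2%:E * (2%:E * f2 k + 2%:E * f1 k + 2%:E * (B * (t2 - t1))%:E)
   + 4%:E * e1 k + 4%:E * e2 k)%E.
  apply: (@le_trans _ _ (\int[P]_w (2%:E * (((x^T *m step_integral W (s k) w) ord0 ord0) ^+ 2)%:E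
     + 4%:E * (enorm (Z1 w - step_integral W (s1 k) w) ^+ 2)%:E
     + 4%:E * (enorm (Z2 w - step_integral W (s2 k) w) ^+ 2)%:E))%E).
    apply: ge0_le_integral => //.
    - by move=> w _; rewrite lee_fin sqr_ge0.
    - by apply/measurable_EFinP/measurable_funX/measurable_dot; exact: random_vectorB.
    - apply: emeasurable_funD; [apply: emeasurable_funD|]; apply: emeasurable_funM => //;
        apply/measurable_EFinP.
      + exact/measurable_funX/measurable_dot.
      + by apply/measurable_funX/measurable_enorm/random_vectorB.
      + by apply/measurable_funX/measurable_enorm/random_vectorB.
    move=> w _; rewrite /s step_integral_sub -!EFinM -!EFinD lee_fin.
    have h1 := sqr_dot_le_enorm (Z1 w - step_integral W (s1 k) w) x1.
    have h2 := sqr_dot_le_enorm (Z2 w - step_integral W (s2 k) w) x1.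
    move: h1 h2; rewrite !mulmxB_entry.
    set a := (_ *m _) _ _; set b := (_ *m _) _ _; set c := (_ *m _) _ _; set e := (_ *m _) _ _.
    move=> h1 h2.
    (* The first square separates the step integral from the total error, the second separates the
       two errors; hence the coefficients 2, 4 and 4. *)
    have q1 := sqr_ge0 ((e - b) - ((c - e) - (a - b))).
    by have q2 := sqr_ge0 ((c - e) + (a - b)); lra.
  have mD1 := measurable_funX 2 (measurable_enorm (random_vectorB mZ1 (mI1 k))).
  have mD2 := measurable_funX 2 (measurable_enorm (random_vectorB mZ2 (mI2 k))).
  rewrite ge0_integral_lin3 //; try (by move=> w; rewrite lee_fin sqr_ge0);
    try exact/measurable_EFinP; last first.
    exact/measurable_EFinP/measurable_funX/measurable_dot.
  apply: leeD2r; apply: leeD2r; rewrite (step_isometry _ fF bW (@sQ k)).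
  by apply: lee_wpmul2l => //; exact: D.
have c0 : (B * (t2 - t1))%:E @[_ --> \oo] --> (B * (t2 - t1))%:E by exact: cvg_cst.
(* All four error sequences tend to 0, so only the term in [B] survives in the limit of the bounds
   [S k]. *)
have L := cvgeD_fin (cvgeD_fin (cvgeZ_fin (c := 2) (cvgeD_fin (cvgeD_fin (cvgeZ_fin (c := 2) s2f)
  (cvgeZ_fin (c := 2) s1f)) (cvgeZ_fin (c := 2) c0))) (cvgeZ_fin (c := 4) s1Z)) (cvgeZ_fin (c := 4) s2Z).
have -> : 4 * (B * (t2 - t1)) = 2 * (2 * 0 + 2 * 0 + 2 * (B * (t2 - t1))) + 4 * 0 + 4 * 0.
  by ring.
by apply: cvge_ge L; apply: nearW.
Qed.

(** * Drift *)

(** Young's inequality V^2 <= V^4 / (2 q) + q / 2 is integrated. The best q would be K^2; taking q =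
    K^2 + e with e > 0 also covers K = 0 and leaves an arbitrarily small loss. *)
Lemma second_moment_le_fourth dp (Omega : measurableType dp) (R : realType)
    (P : probability Omega R) (V : Omega -> R) (K : R) :
  measurable_fun setT V -> 0 <= K ->
  ((\int[P]_w (V w ^+ 4)%:E) `^ (4^-1) <= K%:E)%E ->
  (\int[P]_w (V w ^+ 2)%:E <= (K ^+ 2)%:E)%E.
Proof.
move=> mV K0 VK.
have V40 : (0 <= \int[P]_w (V w ^+ 4)%:E)%E.
  by apply: integral_ge0 => w _; rewrite lee_fin (exprM _ 2 2) sqr_ge0.
have V4 : (\int[P]_w (V w ^+ 4)%:E <= (K ^+ 4)%:E)%E.
  move: V40 VK; case: (integral _ _ _) => [r||] //; last first.
    by rewrite poweRyr ?invr_eq0 ?pnatr_eq0 // leye_eq.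
  rewrite lee_fin poweR_EFin !lee_fin => r0 rK.
  rewrite -[r](@powRr1 _ r) // -[X in r `^ X](@mulVf _ 4) // powRrM powR_mulrn ?powR_ge0 //.
  by rewrite lerXn2r ?nnegrE ?powR_ge0.
apply/lee_addgt0Pr => e e0; set q := K ^+ 2 + e.
have q0 : 0 < q by rewrite /q; have := sqr_ge0 K; lra.
have v4 w : 0 <= V w ^+ 4 by rewrite (exprM _ 2 2) sqr_ge0.
have cq : 0 <= q^-1 / 2 by rewrite divr_ge0 ?invr_ge0 ?(ltW q0).
apply: (@le_trans _ _ (\int[P]_w ((q^-1 / 2)%:E * (V w ^+ 4)%:E + (q / 2)%:E))%E).
  apply: ge0_le_integral => //.
  - by move=> w _; rewrite lee_fin sqr_ge0.
  - exact/measurable_EFinP/measurable_funX.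
  - apply: emeasurable_funD => //; apply: emeasurable_funM => //.
    exact/measurable_EFinP/measurable_funX.
  move=> w _; rewrite -EFinM -EFinD lee_fin -(ler_pM2l q0).
  have -> : q * (q^-1 / 2 * V w ^+ 4 + q / 2) = (V w ^+ 2) ^+ 2 / 2 + q ^+ 2 / 2.
    by rewrite mulrDr !mulrA divff ?gt_eqF //; ring.
  by have := sqr_ge0 (V w ^+ 2 - q); nra.
rewrite ge0_integralD //; last 3 first.
- by move=> w _; rewrite -EFinM lee_fin mulr_ge0.
- by apply: emeasurable_funM => //; exact/measurable_EFinP/measurable_funX.
- by move=> w _; rewrite lee_fin divr_ge0 // ltW.
rewrite ge0_integralZl_EFin //; last 2 first.
- by move=> w _; rewrite lee_fin.
- exact/measurable_EFinP/measurable_funX.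
rewrite integral_cst //= probability_setT mule1.
apply: (@le_trans _ _ ((q^-1 / 2)%:E * (q ^+ 2)%:E + (q / 2)%:E)%E).
  apply: leeD2r; apply: lee_wpmul2l; first by rewrite lee_fin.
  apply: (le_trans V4); rewrite lee_fin /q (exprM K 2 2).
  by have := sqr_ge0 K; nra.
rewrite -EFinM -EFinD -EFinD lee_fin -/q le_eqVlt; apply/orP; left; apply/eqP.
by field; rewrite gt_eqF.
Qed.

(** Cauchy-Schwarz in time, from 2 m g - m^2 <= g^2 with m the average of [g = f - c] over the
    interval. The constant [c] will be the drift at the start of the block. *)
Lemma sqr_Rintegral_le (R : realType) (f : R -> R) (c t1 t2 : R) :
  0 <= t1 -> t1 <= t2 ->
  lebesgue_measure.-integrable `[0, t2]%classic (EFin \o f) ->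
  (((Rintegral lebesgue_measure `[0, t2]%classic f
    - Rintegral lebesgue_measure `[0, t1]%classic f - (t2 - t1) * c) ^+ 2)%:E
  <= (t2 - t1)%:E * \int[lebesgue_measure]_(u in `]t1, t2]%classic) ((f u - c) ^+ 2)%:E)%E.
Proof.
move=> t10 t12 itf; set D := `]t1, t2]%classic.
have DS : D `<=` `[0, t2]%classic.
  move=> u; rewrite /D /= !in_itv /= => /andP[h ->].
  by rewrite andbT ltW // (le_lt_trans t10).
have mDs : measurable D by exact: measurable_itv.
have itD : lebesgue_measure.-integrable D (EFin \o f).
  by apply: (@integrableS _ _ _ lebesgue_measure _ _ _ _ _ _ itf); [exact: measurable_itv|exact: mDs|].
have mD : lebesgue_measure D = (t2 - t1)%:E by exact: lebesgue_measure_itv_oc.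
have itc k : lebesgue_measure.-integrable D (EFin \o (fun=> k)).
  apply/integrableP; split; first exact/measurable_EFinP.
  by rewrite /= integral_cst // [X in (_ * X)%E](_ : _ = (t2 - t1)%:E) // -EFinM ltry.
rewrite Rintegral_itvB ?bnd_simp // -/D.
have -> : Rintegral lebesgue_measure D f - (t2 - t1) * c =
    Rintegral lebesgue_measure D (fun u => f u - c).
  rewrite RintegralB // Rintegral_cst // [X in c * fine X](_ : _ = (t2 - t1)%:E) //=.
  by rewrite [c * _]mulrC.
set g := fun u => f u - c.
have itg : lebesgue_measure.-integrable D (EFin \o g).
  rewrite (_ : EFin \o g = (EFin \o f) \- (EFin \o fun=> c))%E; first exact: integrableB.
  by apply/funext => u /=.
have mg : measurable_fun D g by apply/measurable_EFinP; exact: measurable_int itg.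
have mg2 : measurable_fun D (fun u => (g u ^+ 2)%:E) by exact/measurable_EFinP/measurable_funX.
move: t12; rewrite le_eqVlt => /predU1P[t12|t12].
  rewrite /D -t12 set_itvoc0 Rintegral_set0 expr0n /=.
  by rewrite integral_set0 mule0.
have T0 : 0 < t2 - t1 by rewrite subr_gt0.
set T := t2 - t1; set A := Rintegral _ _ _.
(* Only integrability of [f] is assumed, so the integral of the square may be infinite; the bound is
   then trivial because the interval has positive length. *)
have [igy|igy] := eqVneq (\int[lebesgue_measure]_(u in D) (g u ^+ 2)%:E)%E +oo%E.
  by rewrite igy gt0_muley ?leey // lte_fin.
have itg2 : lebesgue_measure.-integrable D (EFin \o (fun u => g u ^+ 2)).
  apply/integrableP; split => //=.
  by under eq_integral do rewrite /= ger0_norm ?sqr_ge0 //; rewrite ltey.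
pose G := Rintegral lebesgue_measure D (fun u => g u ^+ 2).
have GE : (\int[lebesgue_measure]_(u in D) (g u ^+ 2)%:E = G%:E)%E.
  by rewrite /G /Rintegral fineK // integrable_fin_num.
rewrite GE -EFinM lee_fin.
have itZ : lebesgue_measure.-integrable D (EFin \o (fun u => 2 * (A / T) * g u)).
  rewrite (_ : EFin \o _ = fun u => ((2 * (A / T))%:E * (EFin \o g) u)%E).
    exact: integrableZl.
  by apply/funext => u; rewrite /= EFinM.
have : Rintegral lebesgue_measure D (fun u => 2 * (A / T) * g u - (A / T) ^+ 2) <= G.
  apply: le_Rintegral => //.
    rewrite (_ : EFin \o _ = (EFin \o (fun u => 2 * (A / T) * g u)%R) \- (EFin \o fun=> ((A / T) ^+ 2)%R))%E.
      exact: integrableB.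
    by apply/funext => u /=.
  by move=> u _; have := sqr_ge0 (g u - A / T); lra.
rewrite RintegralB // RintegralZl // Rintegral_cst // [X in _ ^+ 2 * fine X](_ : _ = T%:E) //= -/A.
rewrite (_ : 2 * (A / T) * A - (A / T) ^+ 2 * T = A ^+ 2 / T); last first.
  by field; rewrite gt_eqF.
by rewrite ler_pdivrMr // mulrC.
Qed.

(** By Tonelli the path integral of the norm has finite expectation, hence is finite almost surely,
    and it dominates every coordinate. This ensures that [int_drift] is a genuine integral with
    additivity in time. *)
Lemma ae_drift_integrable dp (Omega : measurableType dp) (R : realType)
    (P : probability Omega R) (F : R -> set (set Omega)) d (b : R -> Omega -> 'cV[R]_d) :
  drift_process P F b ->
  {ae P, forall w i, lebesgue_measure.-integrable `[0 : R, 1 : R]%classic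
     (fun u => (b u w i 0)%:E)}.
Proof.
move=> [_ mb ib].
pose D : set (R * Omega) := `[0 : R, 1 : R]%classic `*` [set: Omega].
have mD : measurable D by apply: measurableX => //; exact: measurable_itv.
have mn : measurable_fun D (fun z : R * Omega => (enorm (b z.1 z.2))%:E).
  by apply/measurable_EFinP/measurable_enorm => i; exact: mb.
pose g : R * Omega -> \bar R := (fun z => (enorm (b z.1 z.2))%:E) \_ D.
have mg : measurable_fun setT g by exact: ((measurable_restrictT _ mD).1 mn).
have g0 z : (0 <= g z)%E by rewrite /g patchE; case: ifP => // _; rewrite lee_fin sqrtr_ge0.
have gE w : (\int[lebesgue_measure]_u g (u, w) =
    \int[lebesgue_measure]_(u in `[0%R, 1%R]%classic) (enorm (b u w))%:E)%E.
  rewrite [RHS]integral_mkcond; apply: eq_integral => u _.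
  rewrite /g !patchE; congr (if _ then _ else _).
  by apply/idP/idP; rewrite !inE => // -[].
have mG := @measurable_fun_fubini_tonelli_G _ _ _ _ _ lebesgue_measure g mg g0.
have iG : P.-integrable setT (fubini_G lebesgue_measure g).
  apply/integrableP; split => //.
  rewrite (eq_integral (fun w => \int[lebesgue_measure]_(u in `[0%R, 1%R]%classic) (enorm (b u w))%:E)%E) //.
  by move=> w _; rewrite /fubini_G gE gee0_abs // integral_ge0 // => u _; rewrite lee_fin sqrtr_ge0.
apply: filterS (integrable_ae measurableT iG) => w /(_ I) fw i.
rewrite /fubini_G gE ge0_fin_numE in fw; last first.
  by apply: integral_ge0 => u _; rewrite lee_fin sqrtr_ge0.
have msec (f : R * Omega -> R) : measurable_fun D f ->
    measurable_fun `[0 : R, 1 : R]%classic (fun u => f (u, w)).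
  move=> mf; apply/(measurable_restrictT _ _).2; first exact: measurable_itv.
  rewrite (_ : _ \_ _ = fun u => (f \_ D) (u, w)).
    exact: (measurable_fun_pair1 w ((measurable_restrictT _ mD).1 mf)).
  apply/funext => u; rewrite !patchE; congr (if _ then _ else _).
  by apply/idP/idP; rewrite !inE => // -[].
apply/integrableP; split; first by apply/measurable_EFinP; exact: (msec _ (mb i)).
apply: le_lt_trans fw; apply: ge0_le_integral => //.
- by apply/measurable_EFinP; apply: measurableT_comp => //; exact: (msec _ (mb i)).
- by apply/measurable_EFinP; apply: (msec (fun z => enorm (b z.1 z.2))); apply/measurable_EFinP.
move=> u _; rewrite lee_fin -sqrtr_sqr ler_sqrt ?sumr_ge0 // => [|k _]; last exact: sqr_ge0.
by rewrite (bigD1 i) //= lerDl sumr_ge0 // => k _; exact: sqr_ge0.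
Qed.

(** One factor [t2 - t1] comes from Cauchy-Schwarz in time, the other from integrating the moment
    bound over the interval after Tonelli; the factor d from bounding each coordinate by the norm.
    The variable [Y] stands for the projected drift increment, whose own measurability in [w] is not
    at hand: it is only known to equal a measurable function almost surely. *)
Lemma drift_incr dp (Omega : measurableType dp) (R : realType)
    (P : probability Omega R) (F : R -> set (set Omega)) d (b : R -> Omega -> 'cV[R]_d)
    (t0 t1 t2 K : R) (x : 'cV[R]_d) (Y : Omega -> R) :
  filtration F -> drift_process P F b ->
  0 <= t0 <= 1 -> 0 <= t1 -> t1 <= t2 -> t2 <= 1 -> 0 <= K ->
  (forall u, t1 <= u <= t2 ->
     ((\int[P]_w (enorm (b u w - b t0 w) ^+ 4)%:E) `^ (4^-1) <= K%:E)%E) ->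
  \sum_i x i 0 ^+ 2 = 1 -> measurable_fun setT Y ->
  {ae P, forall w, Y w =
    (x^T *m (int_drift b t2 w - int_drift b t1 w - (t2 - t1) *: b t0 w)) ord0 ord0} ->
  (\int[P]_w (Y w ^+ 2)%:E <= (d%:R * ((t2 - t1) ^+ 2 * K ^+ 2))%:E)%E.
Proof.
move=> fF db /andP[t00 t01] t10 t12 t21 K0 bK x1 mY YE.
have rv (u : R) : 0 <= u -> u <= 1 -> random_vector (b u).
  by move=> u0 u1; apply: (adapted_random_vector fF (drift_adapted db)); rewrite //= in_itv /= u0.
have mb0 := rv _ t00 t01.
set I : set R := `]t1, t2]%classic.
have mI : measurable I by exact: measurable_itv.
pose D : set (R * Omega) := I `*` [set: Omega].
have mD : measurable D by apply: measurableX => //; exact: measurable_itv.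
pose f i : R * Omega -> \bar R := fun z => ((b z.1 z.2 i 0 - b t0 z.2 i 0) ^+ 2)%:E.
have mf i : measurable_fun D (f i).
  apply/measurable_EFinP/measurable_funX; apply: measurable_funB.
    apply: measurable_funS (drift_measurable db i).
      by apply: measurableX => //; exact: measurable_itv.
    move=> [u w]; rewrite /D /I /= !in_itv /= => -[/andP[h1 h2] _]; split=> //.
    by rewrite (le_trans t10 (ltW h1)) (le_trans h2).
  apply: measurable_funTS.
  exact: (measurableT_comp (mb0 i) measurable_snd).
pose g i := f i \_ D.
have mg i : measurable_fun setT (g i) by exact: ((measurable_restrictT _ mD).1 (mf i)).
have f0 i z : (0 <= f i z)%E by rewrite lee_fin sqr_ge0.
have g0 i z : (0 <= g i z)%E by rewrite /g patchE; case: ifP.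
have T0 : 0 <= t2 - t1 by rewrite subr_ge0.
pose U i w : \bar R := ((t2 - t1)%:E * \int[lebesgue_measure]_u g i (u, w))%E.
have U0 i w : (0 <= U i w)%E by rewrite mule_ge0 // integral_ge0.
have mU i : measurable_fun setT (U i).
  apply: emeasurable_funM => //.
  exact: (@measurable_fun_fubini_tonelli_G _ _ _ _ _ lebesgue_measure (g i) (mg i) (g0 i)).
apply: (@le_trans _ _ (\int[P]_w (\sum_(i < d) U i w))%E).
  apply: ae_ge0_le_integral => //.
  - by move=> w _; rewrite lee_fin sqr_ge0.
  - exact/measurable_EFinP/measurable_funX.
  - by move=> w _; apply: sume_ge0 => i _.
  - by apply: emeasurable_sum => i.
  apply: filterS2 YE (ae_drift_integrable db) => w -> ib _.
  apply: (@le_trans _ _ (\sum_(i < d) (((int_drift b t2 w - int_drift b t1 w - (t2 - t1) *: b t0 w) i 0) ^+ 2)%:E)%E).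
    by rewrite sumEFin lee_fin (trmul_colE x _ 0); exact: sqr_dot_unit_le.
  apply: lee_sum => i _.
  have -> : (int_drift b t2 w - int_drift b t1 w - (t2 - t1) *: b t0 w) i 0 =
     Rintegral lebesgue_measure `[0, t2]%classic (fun u => b u w i 0)
   - Rintegral lebesgue_measure `[0, t1]%classic (fun u => b u w i 0) - (t2 - t1) * b t0 w i 0.
    by rewrite !mxE.
  apply: (le_trans (sqr_Rintegral_le (b t0 w i 0) t10 t12 _)).
    apply: (@integrableS _ _ _ lebesgue_measure _ _ _ _ _ _ (ib i)).
    - exact: measurable_itv.
    - exact: measurable_itv.
    by move=> u /=; rewrite !in_itv /= => /andP[-> h]; exact: le_trans t21.
  rewrite /U; apply: lee_wpmul2l; first by rewrite lee_fin.
  rewrite integral_mkcond le_eqVlt; apply/orP; left; apply/eqP.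
  apply: eq_integral => u _; rewrite /g /f !patchE; congr (if _ then _ else _).
  by apply/idP/idP; rewrite !inE // => -[].
rewrite ge0_integral_sum //.
have -> : (d%:R * ((t2 - t1) ^+ 2 * K ^+ 2))%:E =
   (\sum_(i < d) ((t2 - t1) ^+ 2 * K ^+ 2)%:E)%E.
  by rewrite sumEFin sumr_const card_ord mulr_natl.
apply: lee_sum => i _; rewrite ge0_integralZl_EFin //; last 2 first.
- by move=> w _; exact: integral_ge0.
- exact: (@measurable_fun_fubini_tonelli_G _ _ _ _ _ lebesgue_measure (g i) (mg i) (g0 i)).
rewrite -(fubini_tonelli (m1 := lebesgue_measure) (m2 := P) (g i) (mg i) (g0 i)).
rewrite expr2 -mulrA EFinM; apply: lee_wpmul2l; first by rewrite lee_fin.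
apply: (@le_trans _ _ (\int[lebesgue_measure]_u ((K ^+ 2)%:E * (\1_I u)%:E))%E).
  apply: ge0_le_integral => //.
  - by move=> u _; exact: integral_ge0.
  - exact: (@measurable_fun_fubini_tonelli_F _ _ _ _ _ P (g i) (mg i) (g0 i)).
  - by apply: emeasurable_funM => //; apply/measurable_EFinP; apply: measurable_indic; exact: mI.
  move=> u _; have [uI|uI] := boolP (u \in I); last first.
    rewrite indicE (negbTE uI) mule0 integral0_eq // => w _.
    by rewrite /g patchE; case: ifP => //; rewrite inE => -[/= /mem_set]; rewrite (negbTE uI).
  rewrite indicE uI mule1.
  have uI' : t1 < u <= t2 by move: uI; rewrite inE /I /= in_itv.
  have [u1 u2] := andP uI'.
  have mbu : random_vector (b u).
    by apply: rv; [rewrite (le_trans t10) // ltW | exact: le_trans t21].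
  apply: le_trans (second_moment_le_fourth _ K0 (bK u _)); last 2 first.
  - by apply: measurable_enorm; exact: random_vectorB.
  - by rewrite u2 ltW.
  apply: ge0_le_integral => //.
  - apply: measurable_fun_pair2; exact: mg.
  - by apply/measurable_EFinP/measurable_funX/measurable_enorm/random_vectorB.
  move=> w _; rewrite /g patchE ifT ?inE // /f /= lee_fin sqr_sqrtr; last first.
    by rewrite sumr_ge0 // => k _; exact: sqr_ge0.
  by rewrite (bigD1 i) //= !mxE lerDl sumr_ge0 // => k _; exact: sqr_ge0.
rewrite ge0_integralZl_EFin ?sqr_ge0 //; last by apply/measurable_EFinP; apply: measurable_indic; exact: mI.
rewrite integral_indic // setIT [X in (_ * X)%E](_ : _ = (t2 - t1)%:E) -?EFinM ?lee_fin 1?mulrC //.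
exact: lebesgue_measure_itv_oc.
Qed.

(** * The test statistic *)

(** The increment is the sum of a martingale part [M] and a drift part. The latter is defined as
    [Y - M], which is measurable and almost surely equal to the centred drift integral; each part
    costs a factor 2. *)
Lemma ito_incr_moment dp (Omega : measurableType dp) (R : realType)
    (P : probability Omega R) (F : R -> set (set Omega)) d m (W : R -> Omega -> 'cV[R]_m)
    (b : R -> Omega -> 'cV[R]_d) (sigma : R -> 'M[R]_(d, m)) (X : R -> Omega -> 'cV[R]_d)
    (t0 t1 t2 B K : R) (x : 'cV[R]_d) :
  filtration F -> brownian_motion P F W -> ito_process P F W b sigma X ->
  0 <= t0 <= 1 -> 0 <= t1 -> t1 <= t2 -> t2 <= 1 -> 0 <= K ->
  \sum_i x i 0 ^+ 2 = 1 ->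
  (forall u, t1 <= u <= t2 -> rownorm_sq x (sigma u) <= B) ->
  (forall u, t1 <= u <= t2 ->
     ((\int[P]_w (enorm (b u w - b t0 w) ^+ 4)%:E) `^ (4^-1) <= K%:E)%E) ->
  (\int[P]_w (((x^T *m (X t2 w - X t1 w - (t2 - t1) *: b t0 w)) ord0 ord0) ^+ 2)%:E
    <= (8 * (B * (t2 - t1)) + 2 * (d%:R * ((t2 - t1) ^+ 2 * K ^+ 2)))%:E)%E.
Proof.
move=> fF bW iX t001 t10 t12 t21 K0 x1 sB bK.
have t20 := le_trans t10 t12; have t11 := le_trans t12 t21.
have r1 : 0 <= t1 <= 1 by rewrite t10.
have r2 : 0 <= t2 <= 1 by rewrite t20.
have [Z1 SZ1 E1] := ito_equation iX r1.
have [Z2 SZ2 E2] := ito_equation iX r2.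
have mX1 := ito_measurable iX r1; have mX2 := ito_measurable iX r2.
have mZ1 := SZ1.1; have mZ2 := SZ2.1.
have mb0 : random_vector (b t0).
  by apply: (adapted_random_vector fF (drift_adapted (ito_drift iX))); case/andP: t001 => //= *; rewrite in_itv /=; apply/andP.
pose M w := (x^T *m (Z2 w - Z1 w)) ord0 ord0.
pose Y w := (x^T *m (X t2 w - X t1 w - (t2 - t1) *: b t0 w)) ord0 ord0.
have mM : measurable_fun setT M by apply: measurable_dot; exact: random_vectorB.
have mY : measurable_fun setT Y.
  apply: measurable_dot; apply: random_vectorB; first exact: random_vectorB.
  move=> i; rewrite (_ : (fun _ => _) = fun w => (t2 - t1) * b t0 w i 0); last first.
    by apply/funext => w; rewrite mxE.
  by apply: measurable_funM => //; exact: mb0.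
have mD : measurable_fun setT (fun w => Y w - M w) by exact: measurable_funB.
have hM : (\int[P]_w (M w ^+ 2)%:E <= (4 * (B * (t2 - t1)))%:E)%E.
  exact: (stochastic_integral_incr fF bW (volatility_measurable (ito_volatility iX))
    t10 t12 t21 x1 sB SZ1 SZ2).
have hD : (\int[P]_w ((Y w - M w) ^+ 2)%:E <= (d%:R * ((t2 - t1) ^+ 2 * K ^+ 2))%:E)%E.
  apply: (drift_incr fF (ito_drift iX) t001 t10 t12 t21 K0 bK x1 mD).
  apply: filterS2 E1 E2 => w e1 e2; rewrite /Y /M -mulmxB_entry e1 e2.
  congr ((_ *m _) _ _).
  by apply/matrixP => i j; rewrite !mxE; ring.
(* The zero summand is padding that brings the integrand into the three-term form of
   [ge0_integral_lin3]. *)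
apply: (@le_trans _ _ (\int[P]_w (2%:E * (M w ^+ 2)%:E + 2%:E * ((Y w - M w) ^+ 2)%:E + 0%:E * 0))%E).
  apply: ge0_le_integral => //.
  - by move=> w _; rewrite lee_fin sqr_ge0.
  - by apply/measurable_EFinP/measurable_funX.
  - apply: emeasurable_funD => //; apply: emeasurable_funD; apply: emeasurable_funM => //;
      exact/measurable_EFinP/measurable_funX.
  move=> w _; rewrite mule0 adde0 -/(Y w) -!EFinM -EFinD lee_fin.
  by have := sqr_ge0 (M w - (Y w - M w)); lra.
rewrite (@ge0_integral_lin3 _ _ _ _ _ _ _ _ _ (fun=> 0%E)) //; first last.
- by move=> w; rewrite lee_fin sqr_ge0.
- by move=> w; rewrite lee_fin sqr_ge0.
- exact/measurable_EFinP/measurable_funX.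
- exact/measurable_EFinP/measurable_funX.
rewrite integral0 mule0 adde0 [leRHS]EFinD; apply: leeD.
  apply: (le_trans (lee_wpmul2l _ hM)); first by rewrite lee_fin.
  by rewrite -EFinM lee_fin; lra.
apply: (le_trans (lee_wpmul2l _ hD)); first by rewrite lee_fin.
by rewrite -EFinM lee_fin.
Qed.

(** The two sums differ by N (a - mu)^2, where mu is the mean. *)
Lemma sum_sqr_centered_le (R : realFieldType) (N : nat) (y : nat -> R) (a : R) : (0 < N)%N ->
  \sum_(1 <= i < N.+1) (y i - N%:R^-1 * \sum_(1 <= j < N.+1) y j) ^+ 2
    <= \sum_(1 <= i < N.+1) (y i - a) ^+ 2.
Proof.
move=> N0; set S := \sum_(1 <= j < N.+1) y j; set mu := N%:R^-1 * S.
have NR : N%:R != 0 :> R by rewrite pnatr_eq0 -lt0n.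
have E c : \sum_(1 <= i < N.+1) (y i - c) ^+ 2 =
    \sum_(1 <= i < N.+1) y i ^+ 2 - 2 * c * S + N%:R * c ^+ 2.
  transitivity (\sum_(1 <= i < N.+1) (y i ^+ 2 - 2 * c * y i + c ^+ 2)).
    by apply: eq_bigr => i _; ring.
  rewrite big_split sumrB /= -mulr_sumr sumr_const_nat subn1 /= -/S.
  by rewrite -[_ *+ N]mulr_natl.
rewrite !E -!addrA lerD2l -subr_ge0.
have -> : - (2 * a * S) + N%:R * a ^+ 2 - (- (2 * mu * S) + N%:R * mu ^+ 2) =
   N%:R * (a - mu) ^+ 2.
  by rewrite (_ : S = N%:R * mu) /mu; [ring | rewrite mulVKf].
by rewrite mulr_ge0 ?sqr_ge0.
Qed.

Lemma qform_sum_outer (R : comPzRingType) d (c : R) (s : seq nat) (v : nat -> 'cV[R]_d) (x : 'cV[R]_d) :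
  qform (c *: \sum_(i <- s) v i *m (v i)^T) x = c * \sum_(i <- s) ((x^T *m v i) 0 0) ^+ 2.
Proof.
rewrite /qform -scalemxAr -scalemxAl mxE mulmx_sumr mulmx_suml summxE; congr (_ * _).
apply: eq_bigr => i _; have -> : x^T *m (v i *m (v i)^T) *m x = (x^T *m v i) *m ((v i)^T *m x) by rewrite !mulmxA.
rewrite [LHS]mxE big_ord1 expr2; congr (_ * _).
by rewrite -[in LHS](trmxK x) -trmx_mul mxE.
Qed.

Lemma block_time_ge0 (R : realType) (n k i : nat) (h : R) : 0 < h -> (0 < i)%N ->
  0 <= k%:R * h + (i%:R - 1) / n%:R.
Proof.
move=> h0 i0; apply: addr_ge0; first by rewrite mulr_ge0 // ltW.
by apply: divr_ge0 => //; rewrite subr_ge0 ler1n.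
Qed.

Lemma block_time_le (R : realType) (n N M k i : nat) (h : R) : (0 < n)%N -> 0 < h ->
  N%:R = n%:R * h -> M%:R = h^-1 -> (k < M)%N -> (i <= N)%N ->
  k%:R * h + i%:R / n%:R <= k%:R * h + h /\ k%:R * h + h <= 1.
Proof.
move=> n0 h0 NE ME kM iN; split.
  rewrite lerD2l ler_pdivrMr ?ltr0n // mulrC -NE ler_nat //.
have : k.+1%:R <= h^-1 by rewrite -ME ler_nat.
by rewrite -(ler_pM2r h0) mulVf ?gt_eqF // -natr1 mulrDl mul1r.
Qed.

Lemma block_times_unit_itv (R : realType) (n N M : nat) (k i : nat) (h : R) :
  (0 < n)%N -> 0 < h -> N%:R = n%:R * h -> M%:R = h^-1 -> (k < M)%N -> (1 <= i <= N)%N ->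
  (0 <= k%:R * h + (i%:R - 1) / n%:R <= 1) /\ (0 <= k%:R * h + i%:R / n%:R <= 1).
Proof.
move=> n0 h0 NE ME kM /andP[i0 iN].
have [a1 a2] := block_time_le n0 h0 NE ME kM iN.
have b0 := block_time_ge0 n k h0 i0.
have nR : 0 < n%:R :> R by rewrite ltr0n.
have d1 : k%:R * h + (i%:R - 1) / n%:R <= k%:R * h + i%:R / n%:R.
  by rewrite lerD2l ler_pM2r ?invr_gt0 // lerBlDr lerDl.
rewrite b0 (le_trans d1 (le_trans a1 a2)) (le_trans b0 d1) (le_trans a1 a2).
by split.
Qed.

(** Measurability of the increments is known only for sampling times in [0,1], so terms outside the
    range are replaced by 0. *)
Lemma measurable_sum_nat dp (T : measurableType dp) (R : realType) a b (f : nat -> T -> R) :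
  (forall i, (a <= i < b)%N -> measurable_fun setT (f i)) ->
  measurable_fun setT (fun w => \sum_(a <= i < b) f i w).
Proof.
move=> mf; rewrite (_ : (fun _ => _) = fun w => \sum_(a <= i < b)
    (if (a <= i < b)%N then f i w else 0)); last first.
  by apply/funext => w; apply: eq_big_nat => i ->.
by apply: measurable_sum => i; case iN: (a <= i < b)%N => //; exact: mf.
Qed.

Lemma random_vector_block_incr dp (Omega : measurableType dp) (R : realType) d
    (n N M k i : nat) (h : R) (X : R -> Omega -> 'cV[R]_d) :
  (0 < n)%N -> 0 < h -> N%:R = n%:R * h -> M%:R = h^-1 -> (k < M)%N -> (1 <= i <= N)%N ->
  (forall t : R, 0 <= t <= 1 -> random_vector (X t)) ->
  random_vector (block_incr n h X i k).
Proof.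
move=> n0 h0 NE ME kM iN mX.
have [a1 a2] := block_times_unit_itv n0 h0 NE ME kM iN.
by apply: random_vectorB; apply: mX.
Qed.

Lemma random_vector_mean_incr dp (Omega : measurableType dp) (R : realType) d
    (n N M k : nat) (h : R) (X : R -> Omega -> 'cV[R]_d) :
  (0 < n)%N -> 0 < h -> N%:R = n%:R * h -> M%:R = h^-1 -> (k < M)%N ->
  (forall t : R, 0 <= t <= 1 -> random_vector (X t)) ->
  random_vector (mean_incr n h X k).
Proof.
move=> n0 h0 NE ME kM mX j.
have bs : block_size n h = N by rewrite /block_size -NE natrK.
rewrite (_ : (fun _ => _) = fun w => (n%:R * h)^-1 *
   \sum_(1 <= i < N.+1) block_incr n h X i k w j 0); last first.
  by apply/funext => w; rewrite /mean_incr bs mxE summxE.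
apply: measurable_funM => //; apply: measurable_sum_nat => i iN.
exact: (random_vector_block_incr n0 h0 NE ME kM iN mX).
Qed.

(** * The estimator on one block *)

Lemma qform_Sigma_hat (Omega : Type) (R : realType) d n (h : R)
    (X : R -> Omega -> 'cV[R]_d) k w (x : 'cV[R]_d) :
  qform (Sigma_hat n h X k w) x = h^-1 *
    \sum_(1 <= i < (block_size n h).+1)
      ((x^T *m (block_incr n h X i k w - mean_incr n h X k w)) 0 0) ^+ 2.
Proof. exact: qform_sum_outer. Qed.

Lemma spd_Sigma_hat (Omega : Type) (R : realType) d n (h : R)
    (X : R -> Omega -> 'cV[R]_d) k w : 0 < h -> spd (Sigma_hat n h X k w).
Proof.
move=> h0; split.
  rewrite /Sigma_hat linearZ /= linear_sum; congr (_ *: _); apply: eq_bigr => i _.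
  by rewrite /= /outer trmx_mul trmxK.
move=> x; rewrite -/(qform _ _) qform_Sigma_hat mulr_ge0 ?invr_ge0 ?(ltW h0) //.
by apply: sumr_ge0 => i _; exact: sqr_ge0.
Qed.

(** Each of the N = n h increments contributes 8 B / n + 2 d K^2 / n^2, and the factor 1/h of the
    estimator turns the sum into n times this quantity. *)
Lemma block_qform_moment dp (Omega : measurableType dp) (R : realType)
    (P : probability Omega R) (F : R -> set (set Omega)) d m (W : R -> Omega -> 'cV[R]_m)
    (b : R -> Omega -> 'cV[R]_d) (sigma : R -> 'M[R]_(d, m)) (X : R -> Omega -> 'cV[R]_d)
    (n N M k : nat) (h B K : R) (x : 'cV[R]_d) :
  filtration F -> brownian_motion P F W -> ito_process P F W b sigma X ->
  (0 < n)%N -> 0 < h -> N%:R = n%:R * h -> M%:R = h^-1 -> (k < M)%N -> 0 <= K ->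
  \sum_i x i 0 ^+ 2 = 1 ->
  (forall u, k%:R * h <= u <= k%:R * h + h -> rownorm_sq x (sigma u) <= B) ->
  (forall u, k%:R * h <= u <= k%:R * h + h ->
     ((\int[P]_w (enorm (b u w - b (k%:R * h) w) ^+ 4)%:E) `^ (4^-1) <= K%:E)%E) ->
  measurable_fun setT (fun w => qform (Sigma_hat n h X k w) x) /\
  (\int[P]_w (qform (Sigma_hat n h X k w) x)%:E
    <= (8 * B + 2 * d%:R * (K ^+ 2 / n%:R))%:E)%E.
Proof.
move=> fF bW iX n0 h0 NE ME kM K0 x1 sB bK.
have bs : block_size n h = N.
  by rewrite /block_size -NE natrK.
have N0 : (0 < N)%N by rewrite -(ltr_nat R) NE mulr_gt0 // ltr0n.
have nR : 0 < n%:R :> R by rewrite ltr0n.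
pose t1 (i : nat) : R := k%:R * h + (i%:R - 1) / n%:R.
pose t2 (i : nat) : R := k%:R * h + i%:R / n%:R.
have tk (i : nat) : (1 <= i <= N)%N -> [/\ k%:R * h <= t1 i, 0 <= t1 i, t1 i <= t2 i,
    t2 i <= k%:R * h + h & t2 i <= 1] /\ t2 i - t1 i = n%:R^-1.
  move=> /andP[i0 iN]; have [a1 a2] := block_time_le n0 h0 NE ME kM iN.
  have d1 : t2 i - t1 i = n%:R^-1 by rewrite /t1 /t2; field; rewrite gt_eqF.
  split => //; split => //.
  - by rewrite lerDl divr_ge0 // subr_ge0 ler1n.
  - exact: block_time_ge0.
  - by rewrite -subr_ge0 d1 invr_ge0 ltW.
  - exact: le_trans a2.
have kh0 : 0 <= k%:R * h by rewrite mulr_ge0 // ltW.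
have kh1 : k%:R * h <= 1.
  by have [_] := block_time_le n0 h0 NE ME kM (leqnn N); lra.
have mb0 : random_vector (b (k%:R * h)).
  apply: (adapted_random_vector fF (drift_adapted (ito_drift iX))) => //=.
  by rewrite in_itv /= kh0.
have mX := ito_measurable iX.
have mI i : (1 <= i < N.+1)%N -> random_vector (block_incr n h X i k).
  by move=> iN; apply: random_vector_block_incr n0 h0 NE ME kM iN mX.
have mm := random_vector_mean_incr n0 h0 NE ME kM mX.
pose c i w := if (1 <= i < N.+1)%N then
  ((x^T *m (block_incr n h X i k w - mean_incr n h X k w)) ord0 ord0) ^+ 2 else 0.
pose y i w := if (1 <= i < N.+1)%N then
  ((x^T *m (block_incr n h X i k w - n%:R^-1 *: b (k%:R * h) w)) ord0 ord0) ^+ 2 else 0.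
have mc i : measurable_fun setT (c i).
  rewrite /c; case iN: (1 <= i < N.+1)%N => //; apply/measurable_funX/measurable_dot/random_vectorB => //.
  exact: mI.
have my i : measurable_fun setT (y i).
  rewrite /y; case iN: (1 <= i < N.+1)%N => //; apply/measurable_funX/measurable_dot/random_vectorB.
    exact: mI.
  move=> j; rewrite (_ : (fun _ => _) = fun w => n%:R^-1 * b (k%:R * h) w j 0); last first.
    by apply/funext => w; rewrite mxE.
  by apply: measurable_funM => //; exact: mb0.
have y0 i w : 0 <= y i w by rewrite /y; case: ifP => // _; exact: sqr_ge0.
have qE w : qform (Sigma_hat n h X k w) x = h^-1 * \sum_(1 <= i < N.+1) c i w.
  rewrite qform_Sigma_hat bs; congr (_ * _); apply: eq_big_nat => i iN.
  by rewrite /c iN.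
have mq : measurable_fun setT (fun w => qform (Sigma_hat n h X k w) x).
  under eq_fun do rewrite qE.
  by apply: measurable_funM => //; exact: measurable_sum.
have q_le w : qform (Sigma_hat n h X k w) x <= h^-1 * \sum_(1 <= i < N.+1) y i w.
  rewrite qE ler_pM2l ?invr_gt0 //.
  pose z i := (x^T *m block_incr n h X i k w) ord0 ord0.
  have -> : \sum_(1 <= i < N.+1) c i w =
      \sum_(1 <= i < N.+1) (z i - N%:R^-1 * \sum_(1 <= j < N.+1) z j) ^+ 2.
    apply: eq_big_nat => i iN; rewrite /c iN mulmxB_entry; congr ((_ - _) ^+ 2).
    rewrite /mean_incr bs -NE -scalemxAr mxE mulmx_sumr summxE; congr (_ * _).
  (* The comparison value is the increment that the drift frozen at the start of the block would
     produce over one time step 1/n, projected on [x]. *)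
  apply: (le_trans (sum_sqr_centered_le _ (n%:R^-1 * (x^T *m b (k%:R * h) w) ord0 ord0) N0)).
  rewrite le_eqVlt; apply/orP; left; apply/eqP; apply: eq_big_nat => i iN.
  by rewrite /y iN mulmxB_entry -scalemxAr [X in _ = (_ - X) ^+ 2]mxE.
split=> //.
apply: (@le_trans _ _ (\int[P]_w ((h^-1)%:E * \sum_(1 <= i < N.+1) (y i w)%:E))%E).
  apply: ge0_le_integral => //.
  - by move=> w _; rewrite lee_fin; have [_] := spd_Sigma_hat n X k w h0; apply.
  - exact/measurable_EFinP.
  - by apply: emeasurable_funM => //; apply: emeasurable_sum => i; exact/measurable_EFinP.
  by move=> w _; rewrite sumEFin -EFinM lee_fin.
have hi0 : 0 <= h^-1 by rewrite invr_ge0 ltW.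
rewrite ge0_integralZl_EFin //; last 2 first.
- by move=> w _; apply: sume_ge0 => i _; rewrite lee_fin.
- by apply: emeasurable_sum => i; exact/measurable_EFinP.
rewrite ge0_integral_sum //; last 2 first.
- by move=> i; exact/measurable_EFinP.
- by move=> i w _; rewrite lee_fin.
apply: (@le_trans _ _ ((h^-1)%:E * \sum_(1 <= i < N.+1)
    (8 * (B / n%:R) + 2 * (d%:R * (n%:R^-1 ^+ 2 * K ^+ 2)))%:E)%E).
  apply: lee_wpmul2l; first by rewrite lee_fin.
  rewrite !big_nat; apply: lee_sum => i iN.
  have [[a0 a1 a2 a3 a4] d1] := tk i iN.
  rewrite /y iN.
  have := @ito_incr_moment _ _ _ _ _ _ _ _ _ _ _ (k%:R * h) (t1 i) (t2 i) B K x fF bW iX.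
  rewrite d1; apply => //; first by rewrite kh0.
  - move=> u /andP[u1 u2]; apply: sB.
    by rewrite (le_trans a0) // (le_trans u2).
  - move=> u /andP[u1 u2]; apply: bK.
    by rewrite (le_trans a0) // (le_trans u2).
rewrite sumEFin -EFinM lee_fin sumr_const_nat subn1 /= -[_ *+ N]mulr_natl NE.
rewrite le_eqVlt; apply/orP; left; apply/eqP; field.
by rewrite !gt_eqF.
Qed.

(** * From one block to the rejection probability *)

Lemma col_orthogonal_unit (R : comPzRingType) d (V : 'M[R]_d) j :
  V^T *m V = 1%:M -> \sum_i (col j V) i 0 ^+ 2 = 1.
Proof.
move=> /matrixP/(_ j j); rewrite !mxE eqxx mulr1n => <-.
by apply: eq_bigr => i _; rewrite !mxE expr2.
Qed.

Lemma measurable_test_stat dp (Omega : measurableType dp) (R : realType) d n N M (h : R) r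
    (X : R -> Omega -> 'cV[R]_d) :
  (0 < n)%N -> 0 < h -> N%:R = n%:R * h -> M%:R = h^-1 -> (r < d)%N ->
  (forall t : R, 0 <= t <= 1 -> random_vector (X t)) ->
  measurable_fun setT (test_stat n h r X).
Proof.
move=> n0 h0 NE ME rd mX.
have bs : block_size n h = N by rewrite /block_size -NE natrK.
have bn : nb_blocks h = M by rewrite /nb_blocks -ME natrK.
apply: measurable_sum => k; apply: measurable_funM => //.
have kM : (k < M)%N by rewrite -bn.
have mI i : (1 <= i < N.+1)%N -> random_vector (block_incr n h X i k).
  by move=> iN; apply: random_vector_block_incr n0 h0 NE ME kM iN mX.
have mm := random_vector_mean_incr n0 h0 NE ME kM mX.
apply: measurable_lambda => //.
  by move=> w; have [] := spd_Sigma_hat n X k w h0.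
move=> i j; rewrite (_ : (fun _ => _) = fun w => h^-1 * \sum_(1 <= l < N.+1)
    ((block_incr n h X l k w - mean_incr n h X k w) i 0 *
     (block_incr n h X l k w - mean_incr n h X k w) j 0)); last first.
  apply/funext => w; rewrite /Sigma_hat bs mxE summxE; congr (_ * _).
  by apply: eq_bigr => l _; rewrite /outer mxE big_ord1 [_^T _ _]mxE.
apply: measurable_funM => //; apply: measurable_sum_nat => l lN.
by apply: measurable_funM; apply: random_vectorB => //; exact: mI.
Qed.

(** [B] bounds the variance rate in the directions that are null at the start of a block, [K] the
    drift increment in L^4. At most d directions are summed per block, and the block weights h add
    up to 1. This part is common to both critical values, which differ only in [B]. *)
Lemma rejection_le dp (Omega : measurableType dp) (R : realType)
    (P : probability Omega R) (F : R -> set (set Omega)) d m (W : R -> Omega -> 'cV[R]_m)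
    (b : R -> Omega -> 'cV[R]_d) (sigma : R -> 'M[R]_(d, m)) (X : R -> Omega -> 'cV[R]_d)
    (n N M r : nat) (h B K kappa alpha : R) :
  filtration F -> brownian_motion P F W -> ito_process P F W b sigma X ->
  (0 < n)%N -> 0 < h -> N%:R = n%:R * h -> M%:R = h^-1 -> (r < d)%N -> 0 <= B -> 0 <= K ->
  (forall k, (k < M)%N -> exists2 V : 'M[R]_d, V^T *m V = 1%:M &
    forall j : 'I_d, (r <= j)%N -> forall u, k%:R * h <= u <= k%:R * h + h ->
      rownorm_sq (col j V) (sigma u) <= B) ->
  (forall k u, (k < M)%N -> k%:R * h <= u <= k%:R * h + h ->
     ((\int[P]_w (enorm (b u w - b (k%:R * h) w) ^+ 4)%:E) `^ (4^-1) <= K%:E)%E) ->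
  0 < kappa -> d%:R * (8 * B + 2 * d%:R * (K ^+ 2 / n%:R)) <= kappa * alpha ->
  (P [set w | test n h r kappa X w = 1%R] <= alpha%:E)%E.
Proof.
move=> fF bW iX n0 h0 NE ME rd B0 K0 Vex bK kp kle.
have bn : nb_blocks h = M by rewrite /nb_blocks -ME natrK.
(* The basis depends on the block. Choice asks for a matrix at every k, so the zero matrix serves as
   a dummy beyond the last block. *)
have /choice[V VP] : forall k, exists V : 'M[R]_d, (k < M)%N ->
    V^T *m V = 1%:M /\ forall j : 'I_d, (r <= j)%N ->
    forall u, k%:R * h <= u <= k%:R * h + h -> rownorm_sq (col j V) (sigma u) <= B.
  move=> k; have [kM|kM] := boolP (k < M)%N; last by exists 0.
  by have [V V1 V2] := Vex k kM; exists V.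
set C := 8 * B + 2 * d%:R * (K ^+ 2 / n%:R) in kle.
have C0 : 0 <= C.
  by rewrite /C addr_ge0 ?mulr_ge0 ?divr_ge0 ?sqr_ge0.
pose q (k : 'I_(nb_blocks h)) (j : 'I_d) w : R := if (r <= j)%N then
  qform (Sigma_hat n h X k w) (col j (V k)) else 0.
have Q (k : 'I_(nb_blocks h)) j : measurable_fun setT (q k j) /\
    (\int[P]_w (q k j w)%:E <= C%:E)%E.
  rewrite /q; case rj: (r <= j)%N; last by split=> //; rewrite integral0 lee_fin.
  have kM : (k < M)%N by rewrite -bn.
  have [V1 V2] := VP k kM.
  apply: (@block_qform_moment _ _ _ _ F _ _ W b sigma X n N M k h B K) => //.
  - exact: col_orthogonal_unit.
  - exact: V2.
  - by move=> u; exact: bK.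
have q0 k j w : 0 <= q k j w.
  by rewrite /q; case: ifP => // _; have [_] := spd_Sigma_hat n X k w h0; apply.
have Tq w : test_stat n h r X w <= \sum_(k < nb_blocks h) \sum_(j < d) h * q k j w.
  apply: ler_sum => k _; rewrite -mulr_sumr ler_pM2l //.
  have kM : (k < M)%N by rewrite -bn.
  have [V1 _] := VP k kM.
  apply: (le_trans (lambda_le_sum (spd_Sigma_hat n X k w h0) V1 rd)).
  by rewrite big_mkcond.
have mA : measurable [set w | kappa < test_stat n h r X w].
  have mT := measurable_test_stat n0 h0 NE ME rd (ito_measurable iX).
  have := mT measurableT `]kappa, +oo[%classic (measurable_itv _).
  by rewrite setTI preimage_itvoy.
have -> : [set w | test n h r kappa X w = 1] = [set w | kappa < test_stat n h r X w].
  apply/seteqP; split => w; rewrite /= /test indicE.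
    by case: (boolP (w \in _)) => [/set_mem //|_ /eqP]; rewrite eq_sym oner_eq0.
  by move=> kT; rewrite mem_set.
set A := [set w | _].
have intA : (kappa%:E * P A <= (kappa * alpha)%:E)%E.
  apply: (@le_trans _ _ (\int[P]_w (\sum_(k < nb_blocks h) \sum_(j < d) h%:E * (q k j w)%:E))%E).
    rewrite -[X in (_ * P X)%E](setIT A) -integral_indic // -ge0_integralZl_EFin //; last 2 first.
    - by apply/measurable_EFinP; exact: measurable_indic.
    - exact: ltW.
    apply: ge0_le_integral => //.
    - by move=> w _; rewrite mule_ge0 // lee_fin // ltW.
    - by apply: emeasurable_funM => //; apply/measurable_EFinP; exact: measurable_indic.
    - apply: emeasurable_sum => k; apply: emeasurable_sum => j; apply: emeasurable_funM => //.
      by apply/measurable_EFinP; exact: (Q k j).1.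
    move=> w _; rewrite indicE.
    have E : (\sum_(k < nb_blocks h) \sum_(j < d) h%:E * (q k j w)%:E)%E =
        (\sum_(k < nb_blocks h) \sum_(j < d) h * q k j w)%:E.
      by rewrite -sumEFin; apply: eq_bigr => k _; rewrite -sumEFin.
    rewrite E; case: (boolP (w \in A)) => [/set_mem wA|_].
      by rewrite mule1 lee_fin (le_trans _ (Tq w)) // ltW.
    rewrite mule0 lee_fin; apply: sumr_ge0 => k _; apply: sumr_ge0 => j _.
    by rewrite mulr_ge0 // ltW.
  have mhq k j : measurable_fun setT (fun w => h%:E * (q k j w)%:E)%E.
    by apply: emeasurable_funM => //; apply/measurable_EFinP; exact: (Q k j).1.
  have hq0 k j w : (0 <= h%:E * (q k j w)%:E)%E by rewrite mule_ge0 // lee_fin // ltW.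
  rewrite ge0_integral_sum //; last 2 first.
  - by move=> k; apply: emeasurable_sum => j.
  - by move=> k w _; apply: sume_ge0 => j _.
  apply: (@le_trans _ _ (\sum_(k < nb_blocks h) (h * (d%:R * C))%:E)%E).
    apply: lee_sum => k _; rewrite ge0_integral_sum //.
    have -> : (h * (d%:R * C))%:E = (\sum_(j < d) (h * C)%:E)%E.
      by rewrite sumEFin sumr_const card_ord -[(h * C) *+ d]mulr_natl mulrCA.
    apply: lee_sum => j _; rewrite ge0_integralZl_EFin ?(ltW h0) //; last 2 first.
    - by move=> w _; rewrite lee_fin.
    - by apply/measurable_EFinP; exact: (Q k j).1.
    by rewrite EFinM lee_wpmul2l ?lee_fin ?(ltW h0) //; exact: (Q k j).2.
  by rewrite sumEFin sumr_const card_ord bn -[(h * _) *+ M]mulr_natl ME mulKf ?gt_eqF.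
move: intA; rewrite -[P A]fineK ?fin_num_measure // -EFinM !lee_fin.
by rewrite ler_pM2l.
Qed.

Theorem theorem2p14 (R : realType) (d : nat) (K : R) (hK : 0 < K) :
  exists c1 c2 : R, [/\ 0 < c1, 0 < c2 &
    forall (beta_b beta_S L_b L_S alpha : R) (r : nat),
      0 < beta_S -> beta_S <= beta_b -> beta_b <= 1 ->
      0 <= L_b -> 0 < L_S -> (r < d)%N -> 0 < alpha < 1 ->
    forall (n : nat) (h : R),
      (0 < n)%N -> 0 < h <= 1 ->
      n%:R * h \is a Num.nat -> h^-1 \is a Num.nat ->
      n%:R^-1 <= K * h ->
    forall (disp : measure_display) (Omega : measurableType disp)
           (P : probability Omega R) (F : R -> set (set Omega))
           (m : nat) (W : R -> Omega -> 'cV[R]_m),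
      filtration F -> brownian_motion P F W ->
      (ereal_sup
         (rejection_probs P F W n h r
            (kappa_nogap n h beta_b beta_S L_b L_S c1 c2 alpha)
            (@H0 disp Omega R P F d r beta_b beta_S L_b L_S))
       <= alpha%:E)%E
      /\
      (forall lam : R, 0 < lam ->
        (ereal_sup
           (rejection_probs P F W n h r
              (kappa_gap n h beta_S L_b L_S lam c1 c2 alpha)
              (@H0_gap disp Omega R P F d r beta_b beta_S L_b L_S lam))
         <= alpha%:E)%E)].
Proof.
have d0 : 0 <= d%:R :> R by [].
(* 8 d and 2 d^2 are the coefficients in [rejection_le]. The added 1 keeps both constants positive
   even for d = 0 and makes the comparison with [kappa * alpha] strict, from which [0 < kappa]
   follows. *)
exists (8 * d%:R + 1), (2 * d%:R ^+ 2 + 1); split.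
- by lra.
- by have := sqr_ge0 (d%:R : R); lra.
move=> bb bS Lb LS alpha r bS0 bSb bb1 Lb0 LS0 rd /andP[al0 al1] n h n0 /andP[h0 h1].
move=> /natrP[N NE] /natrP[M ME] _ disp Omega P F m W fF bW.
have nR : 0 < n%:R :> R by rewrite ltr0n.
have hS0 : 0 < h `^ bS by exact: powR_gt0.
have hb0 : 0 < h `^ bb by exact: powR_gt0.
(* As h <= 1, the larger exponent gives the smaller power. Without gap, one of the two drift factors
   is traded for the power with exponent [bS]; with gap, both are. *)
have hbS : h `^ bb <= h `^ bS by rewrite ger_powR ?h0.
have Kb0 : 0 <= Lb * h `^ bb by rewrite mulr_ge0 // ltW.
have blk k u : (k < M)%N -> k%:R * h <= u <= k%:R * h + h ->
    [/\ 0 <= k%:R * h <= 1, 0 <= u <= 1 & `|u - k%:R * h| <= h].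
  move=> kM /andP[u1 u2].
  have k0 : 0 <= k%:R * h by rewrite mulr_ge0 // ltW.
  have [_ k1] := block_time_le n0 h0 (esym NE) (esym ME) kM (leq0n N).
  split; [lra | lra |].
  by rewrite ger0_norm; lra.
have drift (b : R -> Omega -> 'cV[R]_d) : holder_drift P F bb Lb b ->
    forall k u, (k < M)%N -> k%:R * h <= u <= k%:R * h + h ->
     ((\int[P]_w (enorm (b u w - b (k%:R * h) w) ^+ 4)%:E) `^ (4^-1) <= (Lb * h `^ bb)%:E)%E.
  move=> [_ Hb] k u kM uk; have [/andP[k0 k1] /andP[u0 u1] uh] := blk k u kM uk.
  have /andP[ku _] := uk.
  apply: (le_trans (Hb u (k%:R * h) k0 ku u1)); rewrite lee_fin ler_wpM2l //.
  by rewrite ge0_ler_powR // ?nnegrE // ?(ltW h0) // ltW // (lt_le_trans bS0).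
(* The increment of [Sigma] on a block controls both bounds on the kernel. *)
have vol (Sigma : R -> 'M[R]_d) (sigma : R -> 'M[R]_(d, m)) : holder_cov bS LS Sigma ->
    (forall t : R, 0 <= t <= 1 -> Sigma t = sigma t *m (sigma t)^T) ->
    forall (k : nat) (u : R) (x : 'cV[R]_d), (k < M)%N -> k%:R * h <= u <= k%:R * h + h ->
    \sum_i x i 0 ^+ 2 = 1 -> Sigma (k%:R * h) *m x = 0 ->
    rownorm_sq x (sigma u) = qform (Sigma u) x /\
    \sum_i (Sigma u *m x) i 0 ^+ 2 <= (LS * h `^ bS) ^+ 2.
  move=> [_ HS] Ss k u x kM uk x1 Sx; have [kk uu uh] := blk k u kM uk.
  split; first by rewrite rownorm_sq_outer -Ss.
  have -> : Sigma u *m x = (Sigma u - Sigma (k%:R * h)) *m x by rewrite mulmxBl Sx subr0.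
  rewrite -sqr_enorm lerXn2r ?nnegrE ?sqrtr_ge0 ?mulr_ge0 ?(ltW LS0) ?(ltW hS0) //.
  have e1 : enorm x <= 1 by rewrite /enorm x1 sqrtr1.
  apply: (le_trans (spectral_norm_ub _ e1)); apply: (le_trans (HS _ _ kk uu)).
  rewrite ler_wpM2l ?(ltW LS0) // distrC.
  by rewrite distrC ge0_ler_powR // ?nnegrE // ?(ltW h0) // ltW.
have E2 : (Lb * h `^ bb) ^+ 2 / n%:R = Lb ^+ 2 * n%:R^-1 * (h `^ bb * h `^ bb) by ring.
have Lh0 : 0 <= (Lb * h `^ bb) ^+ 2 / n%:R by rewrite divr_ge0 ?sqr_ge0 // ltW.
have Ln0 : 0 <= Lb ^+ 2 * n%:R^-1 by rewrite mulr_ge0 ?sqr_ge0 ?invr_ge0 ?ltW.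
split => [|lam lam0]; apply: ge_ereal_sup => _ [Sigma [b [sigma [X [HC Ss iX ->]]]]].
- have [_ Hb rk HS] := HC.
  set kappa := kappa_nogap _ _ _ _ _ _ _ _ _.
  have kE : kappa * alpha = h `^ bS * ((8 * d%:R + 1) * LS
      + (2 * d%:R ^+ 2 + 1) * Lb ^+ 2 * n%:R^-1 * h `^ bb).
    by rewrite /kappa /kappa_nogap divfK // gt_eqF.
  have ka : d%:R * (8 * (LS * h `^ bS) + 2 * d%:R * ((Lb * h `^ bb) ^+ 2 / n%:R)) < kappa * alpha.
    rewrite kE E2.
    have g1 : Lb ^+ 2 * n%:R^-1 * (h `^ bb * h `^ bb) <= Lb ^+ 2 * n%:R^-1 * (h `^ bS * h `^ bb).
      by rewrite ler_wpM2l // ler_wpM2r // ltW.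
    have g2 : 0 <= Lb ^+ 2 * n%:R^-1 * (h `^ bS * h `^ bb).
      by rewrite mulr_ge0 // mulr_ge0 // ltW.
    have g3 : 0 < LS * h `^ bS by rewrite mulr_gt0.
    have g4 := ler_wpM2l (mulr_ge0 (ler0n R 2) (sqr_ge0 (d%:R : R))) g1.
    move: g1 g2 g3 g4; set p := Lb ^+ 2 * n%:R^-1 * _; set q := Lb ^+ 2 * n%:R^-1 * _.
    move=> g1 g2 g3 g4.
    have -> : d%:R * (8 * (LS * h `^ bS) + 2 * d%:R * p) =
      8 * d%:R * (LS * h `^ bS) + 2 * d%:R ^+ 2 * p by ring.
    have -> : h `^ bS * ((8 * d%:R + 1) * LS + (2 * d%:R ^+ 2 + 1) * Lb ^+ 2 * n%:R^-1 * h `^ bb) =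
      8 * d%:R * (LS * h `^ bS) + LS * h `^ bS + 2 * d%:R ^+ 2 * q + q by rewrite /q; ring.
    by lra.
  have ka0 : 0 < kappa.
    rewrite -(pmulr_lgt0 _ al0); apply: le_lt_trans ka.
    have p1 : 0 <= LS * h `^ bS by rewrite mulr_ge0 // ltW.
    by apply: mulr_ge0 => //; apply: addr_ge0; apply: mulr_ge0 => //; exact: mulr_ge0.
  apply: (rejection_le fF bW iX n0 h0 (esym NE) (esym ME) rd _ Kb0 _ (drift b Hb) ka0 (ltW ka)).
    by rewrite mulr_ge0 // ltW.
  move=> k kM.
  have kk : 0 <= k%:R * h <= 1 by have [] := blk k (k%:R * h) kM; rewrite ?lexx ?lerDl ?(ltW h0).
  have [V VV VP] := kernel_basis (HS.1 _ kk) (rk _ kk).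
  exists V => // j rj u uk.
  have x1 := col_orthogonal_unit j VV.
  have [-> xq] := vol Sigma sigma HS Ss k u _ kM uk x1 (VP j rj).
  have y0 : 0 <= LS * h `^ bS by rewrite mulr_ge0 // ltW.
  (* The bound is used to first order: a square root is taken, and Cauchy-Schwarz with the unit
     vector gives x^T Sigma(u) x <= |Sigma(u) x|. *)
  rewrite -(ler_sqrt _ (sqr_ge0 _)) sqrtr_sqr (ger0_norm y0) in xq.
  apply: le_trans xq.
  rewrite /qform -mulmxA (trmul_colE (col j V) (Sigma u *m col j V) 0).
  apply: (le_trans (ler_norm _)); rewrite -sqrtr_sqr ler_sqrt ?sumr_ge0 // => [|i _].
    exact: sqr_dot_unit_le.
  exact: sqr_ge0.
- have [[_ Hb rk HS] gap] := HC.
  set kappa := kappa_gap _ _ _ _ _ _ _ _ _.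
  have h2 : h `^ (2 * bS) = h `^ bS * h `^ bS.
    by rewrite mulrDl mul1r powRD // (gt_eqF h0) implybT.
  have kE : kappa * alpha = h `^ bS * h `^ bS * ((8 * d%:R + 1) * lam^-1 * LS ^+ 2
      + (2 * d%:R ^+ 2 + 1) * Lb ^+ 2 * n%:R^-1).
    by rewrite /kappa /kappa_gap h2 divfK // gt_eqF.
  have ka : d%:R * (8 * (lam^-1 * (LS * h `^ bS) ^+ 2) + 2 * d%:R * ((Lb * h `^ bb) ^+ 2 / n%:R))
      < kappa * alpha.
    rewrite kE E2.
    have g1 : Lb ^+ 2 * n%:R^-1 * (h `^ bb * h `^ bb) <= Lb ^+ 2 * n%:R^-1 * (h `^ bS * h `^ bS).
      by rewrite ler_wpM2l // ler_pM // ltW.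
    have g2 : 0 <= Lb ^+ 2 * n%:R^-1 * (h `^ bS * h `^ bS).
      by rewrite mulr_ge0 // mulr_ge0 // ltW.
    have g3 : 0 < lam^-1 * (LS * h `^ bS) ^+ 2 by rewrite mulr_gt0 ?invr_gt0 // exprn_gt0 // mulr_gt0.
    have g4 := ler_wpM2l (mulr_ge0 (ler0n R 2) (sqr_ge0 (d%:R : R))) g1.
    move: g1 g2 g3 g4; set p := Lb ^+ 2 * n%:R^-1 * _; set q := Lb ^+ 2 * n%:R^-1 * _.
    set s := lam^-1 * _ => g1 g2 g3 g4.
    have -> : d%:R * (8 * s + 2 * d%:R * p) = 8 * d%:R * s + 2 * d%:R ^+ 2 * p by ring.
    have -> : h `^ bS * h `^ bS * ((8 * d%:R + 1) * lam^-1 * LS ^+ 2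
      + (2 * d%:R ^+ 2 + 1) * Lb ^+ 2 * n%:R^-1) =
      8 * d%:R * s + s + 2 * d%:R ^+ 2 * q + q by rewrite /q /s; ring.
    by lra.
  have ka0 : 0 < kappa.
    rewrite -(pmulr_lgt0 _ al0); apply: le_lt_trans ka.
    have p1 : 0 <= lam^-1 * (LS * h `^ bS) ^+ 2 by rewrite mulr_ge0 ?sqr_ge0 // invr_ge0 ltW.
    by apply: mulr_ge0 => //; apply: addr_ge0; apply: mulr_ge0 => //; exact: mulr_ge0.
  apply: (rejection_le fF bW iX n0 h0 (esym NE) (esym ME) rd _ Kb0 _ (drift b Hb) ka0 (ltW ka)).
    by rewrite mulr_ge0 ?invr_ge0 ?(ltW lam0) ?sqr_ge0.
  move=> k kM.
  have kk : 0 <= k%:R * h <= 1 by have [] := blk k (k%:R * h) kM; rewrite ?lexx ?lerDl ?(ltW h0).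
  have [V VV VP] := kernel_basis (HS.1 _ kk) (rk _ kk).
  exists V => // j rj u uk.
  have x1 := col_orthogonal_unit j VV.
  have [-> xq] := vol Sigma sigma HS Ss k u _ kM uk x1 (VP j rj).
  have [_ uu _] := blk k u kM uk.
  (* Here the squared bound is kept as it is: multiplied by [lam], the variance rate is at most
     |Sigma(u) x|^2 by [gap_qform] at time u, which explains the exponent 2 [bS]. *)
  rewrite -(ler_pM2l lam0) mulVKf ?gt_eqF //; apply: le_trans xq.
  by apply: gap_qform (HS.1 _ uu) (rk _ uu) _ => r0; exact: gap.
Qed.
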